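(* Let $SO(4)$ act on the simplicial manifold $NSO(4)$ by conjugation, and let $E_{1,3}$, $E_{2,2}$ and $\mu$ be the elements defined in the context. Then $$E_{1,3}+E_{2,2}+\mu$$ is a cocycle in $\Omega^4_{SO(4)}(NSO(4))$, the degree-$4$ part of the total complex of the equivariant simplicial de Rham complex of $NSO(4)$.
   Context: Write $G=SO(4)$, with Lie algebra $\mathfrak{so}(4)$ of real skew-symmetric $4\times4$ matrices. The simplicial manifold $NG$: $NG(p)=G^p$ (with $NG(0)$ a point), with face operators $\varepsilon_i:NG(p)\to NG(p-1)$, $\varepsilon_0(g_1,\dots,g_p)=(g_2,\dots,g_p)$, $\varepsilon_i(g_1,\dots,g_p)=(g_1,\dots,g_ig_{i+1},\dots,g_p)$ for $1\le i\le p-1$, $\varepsilon_p(g_1,\dots,g_p)=(g_1,\dots,g_{p-1})$. $G$ acts on $NG(p)$ by $k\cdot(g_1,\dots,g_p)=(kg_1k^{-1},\dots,kg_pk^{-1})$, and the face operators are equivariant. Equivariant forms (Cartan model): for a $G$-manifold $M$, $\Omega_G^*(M)=(\Omega^*(M)\otimes S(\mathfrak{so}(4)^* ))^G$, where $S(\mathfrak{so}(4)^* )$ is the algebra of polynomial functions on $\mathfrak{so}(4)$; elements are regarded as $G$-equivariant polynomial maps $\alpha:\mathfrak{so}(4)\to\Omega^*(M)$. The degree of an element is its form degree plus twice its polynomial degree. The differential is $(d_G\alpha)(X)=(d-i_{X_M})(\alpha(X))$, where $X_M$ is the vector field generated by $X$, with the sign convention $X_M(x)=\frac{d}{dt}\big|_{t=0}\exp(-tX)\cdot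 x$ (so on $G^p$ its components are $h_jX-Xh_j$), and $i$ is contraction. Equivariant simplicial de Rham complex: $\Omega_G^{p,q}(NG)=\Omega_G^q(NG(p))$ with differentials $d'=\sum_{i=0}^{p+1}(-1)^i\varepsilon_i^*:\Omega_G^q(NG(p))\to\Omega_G^q(NG(p+1))$ and $d''=(-1)^pd_G$ on $\Omega_G^*(NG(p))$. The total complex has $\Omega_G^n(NG)=\bigoplus_{p+q=n}\Omega_G^q(NG(p))$ and differential $d'+d''$; a cocycle is an element annihilated by $d'+d''$. Notation for forms: $h$ is the tautological matrix-valued function on $G$, $h_1,h_2$ the two matrix-valued coordinate functions on $G\times G$; subscripts $(\cdot)_{ij}$ denote matrix entries; products of matrix-valued forms use matrix multiplication with wedge products of entries (so $(h^{-1}dh)^2=(h^{-1}dh)\wedge(h^{-1}dh)$), and products of entries of forms are wedge products. $\mathfrak{S}_4$ is the symmetric group on $\{1,2,3,4\}$. The elements are: $$E_{1,3}=\frac{1}{192\pi^2}\sum_{\tau\in\mathfrak{S}_4}\mathrm{sgn}(\tau)\Bigl((h^{-1}dh)_{\tau(1)\tau(2)}(h^{-1}dh)^2_{\tau(3)\tau(4)}+(h^{-1}dh)_{\tau(3)\tau(4)}(h^{-1}dh)^2_{\tau(1)\tau(2)}\Bigr)\in\Omega^3(G),$$ $$E_{2,2}=\frac{-1}{64\pi^2}\sum_{\tau\in\mathfrak{S}_4}\mathrm{sgn}(\tau)\Bigl((h_1^{-1}dh_1)_{\tau(1)\tau(2)}(dh_2\,h_2^{-1})_{\tau(3)\tau(4)}+(h_1^{-1}dh_1)_{\tau(3)\tau(4)}(dh_2\,h_2^{-1})_{\tau(1)\tau(2)}\Bigr)\in\Omega^2(G\times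 G),$$ both regarded as equivariant forms of polynomial degree $0$, lying in $\Omega_G^{1,3}(NG)$ and $\Omega_G^{2,2}(NG)$ respectively, and $\mu\in(\Omega^1(G)\otimes\mathfrak{so}(4)^* )^G\subset\Omega_G^{1,3}(NG)$ given for $X\in\mathfrak{so}(4)$ by $$\mu(X)=-\frac{1}{64\pi^2}\sum_{\tau\in\mathfrak{S}_4}\mathrm{sgn}(\tau)\Bigl(X_{\tau(1)\tau(2)}(h^{-1}dh)_{\tau(3)\tau(4)}+X_{\tau(3)\tau(4)}(h^{-1}dh)_{\tau(1)\tau(2)}\Bigr)-\frac{1}{64\pi^2}\sum_{\tau\in\mathfrak{S}_4}\mathrm{sgn}(\tau)\Bigl(X_{\tau(1)\tau(2)}(dh\,h^{-1})_{\tau(3)\tau(4)}+X_{\tau(3)\tau(4)}(dh\,h^{-1})_{\tau(1)\tau(2)}\Bigr).$$ *)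

(* Defs.v *)
From HB Require Import structures.
From mathcomp Require Import all_boot all_order all_algebra all_fingroup.
From mathcomp Require Import all_classical all_reals all_analysis.

Set Implicit Arguments.
Unset Strict Implicit.
Unset Printing Implicit Defensive.

Import Order.TTheory GRing.Theory Num.Theory.
Import numFieldNormedType.Exports.

Local Open Scope classical_set_scope.
Local Open Scope ring_scope.

(* NG(p) = SO(4)^p is treated as an embedded submanifold of the vector space
   tup p of p-tuples of 4 x 4 matrices.  Differential forms on NG(p) are
   represented by functions on all points and vectors of tup p, but only their
   values at points of NG(p) on vectors tangent to NG(p) are meaningful: being a
   form, and equality of forms (eqf), refer to those values only, and all the
   operations below depend on those values only. *)

Section EquivariantSimplicialDeRham.
Context {R : realType}.

Definition tup (p : nat) := 'I_p -> 'M[R]_4.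

Definition so4 (X : 'M[R]_4) : Prop := X^T = - X.

Definition SO4 (g : 'M[R]_4) : Prop := g^T *m g = 1%:M /\ \det g = 1.

Definition skews (p : nat) : set (tup p) := [set A | forall j, so4 (A j)].

Definition NG (p : nat) : set (tup p) := [set g | forall j, SO4 (g j)].

(* T_g NG(p) = { (g_1 A_1, ..., g_p A_p) | A_j in so(4) } *)
Definition tangent (p : nat) (g v : tup p) : Prop :=
  forall j, so4 (invmx (g j) *m v j).

(* C^n functions on the vector space so(4)^p: n-fold iterated directional
   derivatives exist and are continuous. *)
Fixpoint Cn (p n : nat) (f : tup p -> R) : Prop :=
  {within (@skews p : set {ptws 'I_p -> 'M[R]_4}),
    continuous (f : {ptws 'I_p -> 'M[R]_4} -> R)} /\
  match n with
  | 0 => True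
  | n'.+1 => forall C, skews C ->
      (forall A, skews A -> derivable (fun t : R => f (A + t *: C)) 0 1) /\
      Cn n' (fun A => derive1 (fun t : R => f (A + t *: C)) 0)
  end.

Definition smooth (p : nat) (f : tup p -> R) : Prop := forall n, Cn n f.

Definition dform (p k : nat) := tup p -> ('I_k -> tup p) -> R.

Definition eqf (p k : nat) (w w' : dform p k) : Prop :=
  forall g v, NG g -> (forall i, tangent g (v i)) -> w g v = w' g v.

Definition zerof (p k : nat) : dform p k := fun _ _ => 0.

Definition tmap (p q : nat) (f : tup p -> tup q) (g v : tup p) : tup q :=
  fun j => derive1 (fun t : R => f (g + t *: v) j) 0.

Definition pullback (p q k : nat) (f : tup p -> tup q) (w : dform q k) :
  dform p k := fun g v => w (f g) (fun i => tmap f g (v i)).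

(* Cayley chart of NG(p) centred at g: it is a diffeomorphism from the whole of
   so(4)^p onto an open neighbourhood of g (1 - A/2 is invertible for every real
   skew-symmetric A), it maps 0 to g, and its tangent map at 0 is A |-> gA.
   These charts form a smooth atlas of NG(p). *)
Definition chart (p : nat) (g A : tup p) : tup p :=
  fun j => g j *m (1%:M + 2^-1 *: A j) *m invmx (1%:M - 2^-1 *: A j).

(* w belongs to Omega^k(NG(p)): it is multilinear and alternating on each
   tangent space, and its coefficients in every chart are smooth. *)
Definition is_form (p k : nat) (w : dform p k) : Prop :=
  [/\ forall g v i u u' (a : R), NG g -> (forall j, tangent g (v j)) ->
        tangent g u -> tangent g u' ->
        w g (dfwith v i (a *: u + u')) =
          a * w g (dfwith v i u) + w g (dfwith v i u'),
      forall g v i j, NG g -> (forall l, tangent g (v l)) ->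
        i != j -> v i = v j -> w g v = 0 &
      forall g C, NG g -> (forall i, skews (C i)) ->
        smooth (fun A => pullback (chart g) w A C)].

(* The normalisation for which alpha /\ beta (u, v) =
   alpha u * beta v - alpha v * beta u on 1-forms. *)
Definition wedgef (p k l : nat) (a : dform p k) (b : dform p l) : dform p (k + l) :=
  fun g v => (k`! * l`!)%:R^-1 * \sum_(s : 'S_(k + l)) (-1) ^+ s *
    (a g (fun i => v (s (lshift l i))) * b g (fun i => v (s (rshift k i)))).

(* Exterior derivative, at x, of a form given on the vector space so(4)^p:
   (d w)_x(C_0, ..., C_k) =
     sum_i (-1)^i D_(C_i) (w(C_0, .., omit C_i, .., C_k)) (x). *)
Definition dflat (p k : nat) (w : dform p k) : dform p k.+1 := fun x C =>
  \sum_(i < k.+1) (-1) ^+ i *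
    derive1 (fun t : R => w (x + t *: C i) (fun j => C (lift i j))) 0.

(* Exterior derivative on NG(p), computed in the chart centred at the point g;
   invmx (g j) *m v i j are the coordinates of the tangent vector v i. *)
Definition dext (p k : nat) (w : dform p k) : dform p k.+1 := fun g v =>
  dflat (pullback (chart g) w) 0 (fun i j => invmx (g j) *m v i j).

Definition contractf (p k : nat) (Y : tup p -> tup p) (w : dform p k.+1) :
  dform p k :=
  fun g v => w g (fun i => if unlift ord0 i is Some j then v j else Y g).

Definition conj_act (p : nat) (k : 'M[R]_4) (g : tup p) : tup p :=
  fun j => k *m g j *m invmx k.

(* d/dt|_0 of exp(-tX) . g *)
Definition fundvf (p : nat) (X : 'M[R]_4) (g : tup p) : tup p :=
  fun j => g j *m X - X *m g j.

(* An inhomogeneous form-valued map on so(4): a X k is the component of form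
   degree k of the value at X. *)
Definition eqform (p : nat) := 'M[R]_4 -> forall k, dform p k.

(* b belongs to Omega^k(NG(p)) (x) S^m(so(4)^* ): S^m(so(4)^* ) is spanned by
   the degree m monomials in the matrix entries of X. *)
Definition homog (p k m : nat) (b : 'M[R]_4 -> dform p k) : Prop :=
  exists w : m.-tuple ('I_4 * 'I_4) -> dform p k,
    (forall s, is_form (w s)) /\
    forall X, so4 X -> eqf (b X) (fun g v =>
      \sum_(s : m.-tuple ('I_4 * 'I_4))
        (\prod_(i < m) X (tnth s i).1 (tnth s i).2) * w s g v).

Definition equivariant (p : nat) (a : eqform p) : Prop :=
  forall k X n, SO4 k -> so4 X ->
    eqf (pullback (conj_act k) (a (k *m X *m invmx k) n)) (a X n).

(* a belongs to Omega_G^q(NG(p)): the component of form degree k is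
   homogeneous of polynomial degree m with k + 2m = q. *)
Definition is_eqform (p q : nat) (a : eqform p) : Prop :=
  [/\ forall k m, k + m.*2 = q -> homog m (fun X => a X k),
      forall k, (forall m, k + m.*2 <> q) ->
        forall X, so4 X -> eqf (a X k) (@zerof p k) &
      equivariant a].

Definition dG (p : nat) (a : eqform p) : eqform p := fun X k g v =>
  match k return ('I_k -> tup p) -> R with
  | 0 => fun _ => 0
  | k'.+1 => dext (a X k') g
  end v - contractf (fundvf X) (a X k.+1) g v.
Arguments dG {p} a X k g v.

(* The 0-based component j of the face operator eps_i is g_(j+1) for j + 1 < i,
   g_(j+1) g_(j+2) for j + 1 = i, and g_(j+2) for j + 1 > i, in the 1-based
   numbering of the components of (g_1, ..., g_(p+1)). *)
Definition face (p : nat) (i : 'I_p.+2) (g : tup p.+1) : tup p := fun j =>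
  if (j.+1 < i)%N then g (widen_ord (leqnSn p) j)
  else if j.+1 == i then g (widen_ord (leqnSn p) j) *m g (lift ord0 j)
  else g (lift ord0 j).

Definition dsimp (p : nat) (a : eqform p) : eqform p.+1 := fun X k g v =>
  \sum_(i < p.+2) (-1) ^+ i * pullback (@face p i) (a X k) g v.
Arguments dsimp {p} a X k g v.

(* Elements of the total complex: the component c p lies in Omega_G^*(NG(p)). *)
Definition cochain := forall p, eqform p.

Definition is_cochain (n : nat) (c : cochain) : Prop := forall p,
  if (p <= n)%N then is_eqform (n - p) (c p)
  else forall X k, so4 X -> eqf (c p X k) (@zerof p k).

Definition dtot (c : cochain) : cochain := fun p X k g v =>
  match p return eqform p with
  | 0 => fun _ _ _ _ => 0
  | p'.+1 => dsimp (c p')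
  end X k g v + (-1) ^+ p * dG (c p) X k g v.
Arguments dtot c p X k g v : clear implicits.

Definition is_cocycle (n : nat) (c : cochain) : Prop :=
  is_cochain n c /\
  forall p X k, so4 X -> eqf (dtot c p X k) (@zerof p k).

Definition addc (c c' : cochain) : cochain := fun p X k g v =>
  c p X k g v + c' p X k g v.

Definition hinv_dh (p : nat) (j : 'I_p) : 'M[dform p 1]_4 :=
  \matrix_(a, b) fun g v => (invmx (g j) *m v ord0 j) a b.

Definition dh_hinv (p : nat) (j : 'I_p) : 'M[dform p 1]_4 :=
  \matrix_(a, b) fun g v => (v ord0 j *m invmx (g j)) a b.

Definition mxwedge (p k l : nat) (A : 'M[dform p k]_4) (B : 'M[dform p l]_4) :
  'M[dform p (k + l)]_4 :=
  \matrix_(a, b) fun g v => \sum_(e < 4) wedgef (A a e) (B e b) g v.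

Definition i1 : 'I_4 := @Ordinal 4 0 isT.
Definition i2 : 'I_4 := @Ordinal 4 1 isT.
Definition i3 : 'I_4 := @Ordinal 4 2 isT.
Definition i4 : 'I_4 := @Ordinal 4 3 isT.

Definition E13 : dform 1 3 := fun g v =>
  let th := hinv_dh (ord0 : 'I_1) in
  let th2 := mxwedge th th in
  (192 * pi ^+ 2)^-1 * \sum_(s : 'S_4) (-1) ^+ s *
    (wedgef (th (s i1) (s i2)) (th2 (s i3) (s i4)) g v +
     wedgef (th (s i3) (s i4)) (th2 (s i1) (s i2)) g v).

Definition E22 : dform 2 2 := fun g v =>
  let a := hinv_dh (ord0 : 'I_2) in
  let b := dh_hinv (ord_max : 'I_2) in
  -1 / (64 * pi ^+ 2) * \sum_(s : 'S_4) (-1) ^+ s *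
    (wedgef (a (s i1) (s i2)) (b (s i3) (s i4)) g v +
     wedgef (a (s i3) (s i4)) (b (s i1) (s i2)) g v).

Definition mu (X : 'M[R]_4) : dform 1 1 := fun g v =>
  let a := hinv_dh (ord0 : 'I_1) in
  let b := dh_hinv (ord0 : 'I_1) in
  - (64 * pi ^+ 2)^-1 * (\sum_(s : 'S_4) (-1) ^+ s *
      (X (s i1) (s i2) * a (s i3) (s i4) g v +
       X (s i3) (s i4) * a (s i1) (s i2) g v))
  - (64 * pi ^+ 2)^-1 * (\sum_(s : 'S_4) (-1) ^+ s *
      (X (s i1) (s i2) * b (s i3) (s i4) g v +
       X (s i3) (s i4) * b (s i1) (s i2) g v)).

Definition E13c : cochain := fun p =>
  match p return eqform p with
  | 1 => fun _ k => match k return dform 1 k with 3 => E13 | _ => @zerof 1 _ end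
  | _ => fun _ k => @zerof _ k
  end.

Definition E22c : cochain := fun p =>
  match p return eqform p with
  | 2 => fun _ k => match k return dform 2 k with 2 => E22 | _ => @zerof 2 _ end
  | _ => fun _ k => @zerof _ k
  end.

Definition muc : cochain := fun p =>
  match p return eqform p with
  | 1 => fun X k => match k return dform 1 k with 1 => mu X | _ => @zerof 1 _ end
  | _ => fun _ k => @zerof _ k
  end.

End EquivariantSimplicialDeRham.

Arguments dG {R p} a X k g v.
Arguments dsimp {R p} a X k g v.
Arguments dtot {R} c p X k g v.

(* Main.v *)
(* Let P(A, B) = sum_s sgn(s) A_(s1 s2) B_(s3 s4) be the polarized Pfaffian.  It is
   symmetric and SO(4)-invariant, so P(A, [B, C]) is an invariant alternating
   trilinear form on so(4).  With theta = h^-1 dh, rho = dh h^-1 and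
   K = 1 / (32 pi^2),
     E_(1,3)(u, v, w) = K P(theta u, [theta v, theta w]),
     E_(2,2) = - K P(theta_1 /\ rho_2),   mu(X) = - K (P(X, theta) + P(X, rho)).
   The cocycle condition then follows from d theta = - theta^2, d rho = rho^2, from
   theta(X_M) = X - h^-1 X h and rho(X_M) = h X h^-1 - X, and from the behaviour of
   theta and rho under the multiplication G x G -> G.
   In the Cayley chart centred at g, with N = (1 - A/2)^-1, theta and rho become
   N^T dA N and g N dA N^T g^T; since dN = N (dA/2) N, the coefficients of all the
   forms lie in the algebra generated by the entries of N, which is closed under
   differentiation: hence smoothness and the structure equations. *)
Require Import Defs.
From mathcomp Require Import all_boot all_order all_algebra all_fingroup.
From mathcomp Require Import ring.
From mathcomp Require Import all_classical all_reals all_analysis.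

Set Implicit Arguments.
Unset Strict Implicit.
Unset Printing Implicit Defensive.

Import Order.TTheory GRing.Theory Num.Theory.
Import numFieldNormedType.Exports.

Local Open Scope classical_set_scope.
Local Open Scope ring_scope.

Local Notation o1 := (lift ord0 ord0).
Local Notation o2 := (lift ord0 (lift ord0 ord0)).

Lemma ord2P (i : 'I_2) : i = ord0 \/ i = o1.
Proof. by case: (unliftP ord0 i) => [j|] ->; [right; rewrite ord1|left]. Qed.

Lemma ord3P (i : 'I_3) : [\/ i = ord0, i = o1 | i = o2].
Proof.
case: (unliftP ord0 i) => [j|] ->; last by constructor 1.
by case: (ord2P j) => ->; [constructor 2|constructor 3].
Qed.

(** * Signed sums over small symmetric groups *)

Section AlternatingSums.
Variable R : comPzRingType.

(* Laplace expansion along the image of the first index. *)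
Lemma sum_perm_recl n (G : 'S_n.+1 -> R) :
  \sum_(s : 'S_n.+1) (-1) ^+ s * G s =
  \sum_(j < n.+1) \sum_(s : 'S_n) (-1) ^+ (j + s) * G (lift_perm ord0 j s).
Proof.
rewrite (partition_big (fun s : 'S_n.+1 => s ord0) predT) //=.
apply: eq_bigr => j _; rewrite (reindex (lift_perm ord0 j)); last first.
  (* The inverse of [lift_perm ord0 j]: delete i from the source of s and s i from its target. *)
  pose ulsf i (s : 'S_n.+1) k := odflt k (unlift (s i) (s (lift i k))).
  have ulsfK i (s : 'S_n.+1) k : lift (s i) (ulsf i s k) = s (lift i k).
    rewrite /ulsf; have := neq_lift i k.
    by rewrite -(can_eq (permK s)) => /unlift_some[] ? ? ->.
  have inj_ulsf : injective (ulsf ord0 _).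
    move=> s; apply: can_inj (ulsf (s ord0) s^-1%g) _ => k'.
    by rewrite {1}/ulsf ulsfK !permK liftK.
  exists (fun s => perm (inj_ulsf s)) => [s _ | s].
    by apply/permP => k'; rewrite permE /ulsf lift_perm_lift lift_perm_id liftK.
  move/(s _ =P _) => sj; apply/permP => k.
  case: (unliftP ord0 k) => [k'|] ->; rewrite ?lift_perm_id //.
  by rewrite lift_perm_lift -sj permE ulsfK.
apply: eq_big => [s|s _]; first by rewrite lift_perm_id eqxx.
by congr (_ * _); rewrite -[RHS]signr_odd oddD oddb odd_lift_perm.
Qed.

Lemma sum_perm1 (G : 'S_1 -> R) : \sum_(s : 'S_1) (-1) ^+ s * G s = G 1%g.
Proof.
rewrite (bigD1 1%g) //= odd_perm1 mul1r big1 ?addr0 // => s /eqP[].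
by apply/permP => i; rewrite !ord1.
Qed.

Let lift_permE := (lift_perm_id, lift_perm_lift, perm1).

(** F takes natural numbers, so that iterated lifts of indices compute through [bump] to closed
    numerals and [ring] recognises equal terms. *)
Lemma sum_perm2 (F : nat -> nat -> R) :
  \sum_(s : 'S_2) (-1) ^+ s * F (s ord0) (s o1) = F 0 1 - F 1 0.
Proof.
rewrite sum_perm_recl.
under eq_bigr => j _.
  under eq_bigr do rewrite exprD -mulrA !lift_permE.
  rewrite -mulr_sumr sum_perm1 perm1; over.
rewrite !big_ord_recl big_ord0 /= /bump /=.
by ring.
Qed.

Lemma sum_perm3 (F : nat -> nat -> nat -> R) :
  \sum_(s : 'S_3) (-1) ^+ s *
     F (s ord0) (s o1) (s o2) =
  F 0 1 2 - F 0 2 1 + F 1 2 0 - F 1 0 2 + F 2 0 1 - F 2 1 0.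
Proof.
rewrite sum_perm_recl.
under eq_bigr => j _.
  under eq_bigr do rewrite exprD -mulrA !lift_permE.
  rewrite -mulr_sumr (sum_perm2 (fun a b => F j (bump j a) (bump j b))); over.
rewrite !big_ord_recl big_ord0 /= /bump /=.
by ring.
Qed.

Lemma sum_perm4 (F : nat -> nat -> nat -> nat -> R) :
  \sum_(s : 'S_4) (-1) ^+ s * F (s i1) (s i2) (s i3) (s i4) =
  F 0 1 2 3 - F 0 1 3 2 + F 0 2 3 1 - F 0 2 1 3 + F 0 3 1 2 - F 0 3 2 1
  - (F 1 0 2 3 - F 1 0 3 2 + F 1 2 3 0 - F 1 2 0 3 + F 1 3 0 2 - F 1 3 2 0)
  + (F 2 0 1 3 - F 2 0 3 1 + F 2 1 3 0 - F 2 1 0 3 + F 2 3 0 1 - F 2 3 1 0)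
  - (F 3 0 1 2 - F 3 0 2 1 + F 3 1 2 0 - F 3 1 0 2 + F 3 2 0 1 - F 3 2 1 0).
Proof.
have -> : i1 = ord0 by exact: val_inj.
have -> : i2 = lift ord0 ord0 by exact: val_inj.
have -> : i3 = lift ord0 (lift ord0 ord0) by exact: val_inj.
have -> : i4 = lift ord0 (lift ord0 (lift ord0 ord0)) by exact: val_inj.
rewrite sum_perm_recl.
under eq_bigr => j _.
  under eq_bigr do rewrite exprD -mulrA !lift_permE.
  rewrite -mulr_sumr.
  rewrite (sum_perm3 (fun a b c => F j (bump j a) (bump j b) (bump j c))); over.
rewrite !big_ord_recl big_ord0 /= /bump /=.
by ring.
Qed.

Lemma sum_sign3 (F : 'I_3 -> R) :
  \sum_(i < 3) (-1) ^+ i * F i = F ord0 - F o1 + F o2.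
Proof. by rewrite !big_ord_recl big_ord0 /=; ring. Qed.

Lemma sum_sign4 (F : 'I_4 -> R) :
  \sum_(i < 4) (-1) ^+ i * F i = F ord0 - F o1 + F o2 - F (lift ord0 o2).
Proof. by rewrite !big_ord_recl big_ord0 /=; ring. Qed.

End AlternatingSums.

Lemma big_ord4 (T : Type) (idx : T) (op : Monoid.law idx) (F : 'I_4 -> T) :
  \big[op/idx]_(i < 4) F i = op (op (op (F i1) (F i2)) (F i3)) (F i4).
Proof.
rewrite !big_ord_recl big_ord0 Monoid.mulm1 !Monoid.mulmA.
by congr (op (op (op (F _) (F _)) (F _)) (F _)); exact: val_inj.
Qed.

(** * The polarized Pfaffian *)

Section PfaffianForm.
Variable R : numDomainType.
Implicit Types A B C Z k : 'M[R]_4.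

Definition pf A B : R := \sum_(s : 'S_4) (-1) ^+ s * (A (s i1) (s i2) * B (s i3) (s i4)).

Definition lie A B := A *m B - B *m A.

(** The 24 permutations are grouped by the six ordered splittings of the indices into two pairs.
    This polynomial form makes the algebra of [pf] accessible to [ring]. *)
Lemma pfE A B : pf A B =
  (A i1 i2 - A i2 i1) * (B i3 i4 - B i4 i3)
  + (A i3 i4 - A i4 i3) * (B i1 i2 - B i2 i1)
  - (A i1 i3 - A i3 i1) * (B i2 i4 - B i4 i2)
  - (A i2 i4 - A i4 i2) * (B i1 i3 - B i3 i1)
  + (A i1 i4 - A i4 i1) * (B i2 i3 - B i3 i2)
  + (A i2 i3 - A i3 i2) * (B i1 i4 - B i4 i1).
Proof.
have E : (inord 0 = i1 :> 'I_4) * (inord 1 = i2 :> 'I_4) * (inord 2 = i3 :> 'I_4) *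
    (inord 3 = i4 :> 'I_4).
  by do !split; apply: val_inj; rewrite /= inordK.
pose F (a b c d : nat) := A (inord a) (inord b) * B (inord c) (inord d).
have -> : pf A B = \sum_(s : 'S_4) (-1) ^+ s * F (s i1) (s i2) (s i3) (s i4).
  by apply: eq_bigr => s _; rewrite /F !inord_val.
rewrite sum_perm4 /F !E.
by ring.
Qed.

Lemma pfC A B : pf A B = pf B A.
Proof. by rewrite !pfE; ring. Qed.

Lemma pfDl A B C : pf (A + B) C = pf A C + pf B C.
Proof. by rewrite !pfE !mxE; ring. Qed.

Lemma pfDr A B C : pf A (B + C) = pf A B + pf A C.
Proof. by rewrite !(pfC A) pfDl. Qed.

Lemma pfZl a A B : pf (a *: A) B = a * pf A B.
Proof. by rewrite !pfE !mxE; ring. Qed.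

Lemma pfZr a A B : pf A (a *: B) = a * pf A B.
Proof. by rewrite !(pfC A) pfZl. Qed.

Lemma pfNl A B : pf (- A) B = - pf A B.
Proof. by rewrite -scaleN1r pfZl mulN1r. Qed.

Lemma pfNr A B : pf A (- B) = - pf A B.
Proof. by rewrite !(pfC A) pfNl. Qed.

Lemma pf0l A : pf 0 A = 0.
Proof. by rewrite -(scale0r 0) pfZl mul0r. Qed.

Lemma pf0r A : pf A 0 = 0.
Proof. by rewrite pfC pf0l. Qed.

Lemma pf_conj k A B : pf (k *m A *m k^T) (k *m B *m k^T) = \det k * pf A B.
Proof.
(* By multilinearity both sides are sums over (x, y, z, w) of A x y * B z w times
   the minor of k with column indices x, y, z, w. *)
pose D (M : 'M[R]_4) (x y z w : 'I_4) : R :=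
  \sum_(s : 'S_4) (-1) ^+ s * (M (s i1) x * M (s i2) y * M (s i3) z * M (s i4) w).
(* D M x y z w is the determinant of the matrix with columns x, y, z, w of M, hence of M times a
   column-selection matrix; multiplicativity of the determinant then splits off \det M. *)
have DE M x y z w : D M x y z w = \det M * D 1%:M x y z w.
  pose f := tnth [tuple x; y; z; w].
  have DdetE M' : D M' x y z w = \det (\matrix_(i, j) M' j (f i)).
    by apply: eq_bigr => s _; rewrite big_ord4 !mxE.
  rewrite !DdetE mulrC -[in RHS](det_tr M) -det_mulmx; congr (\det _).
  apply/matrixP => i j; rewrite !mxE (bigD1 (f i)) //= big1 ?addr0 => [|l /negPf lf].
    by rewrite !mxE eqxx mul1r.
  by rewrite !mxE lf mul0r.
have pfD M : pf (M *m A *m M^T) (M *m B *m M^T) =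
    \sum_x \sum_y \sum_z \sum_w A x y * B z w * D M x y z w.
  have congrE C i j : (M *m C *m M^T) i j = \sum_x \sum_y M i x * C x y * M j y.
    rewrite mxE exchange_big; apply: eq_bigr => y _ /=.
    by rewrite !mxE mulr_suml.
  rewrite /pf; under eq_bigr => s _.
    rewrite !congrE mulr_suml mulr_sumr.
    under eq_bigr => x _.
      rewrite mulr_suml mulr_sumr.
      under eq_bigr => y _.
        rewrite !mulr_sumr.
        under eq_bigr do rewrite !mulr_sumr.
        over.
      over.
    over.
  rewrite exchange_big; apply: eq_bigr => x _ /=.
  rewrite exchange_big; apply: eq_bigr => y _ /=.
  rewrite exchange_big; apply: eq_bigr => z _ /=.
  rewrite exchange_big; apply: eq_bigr => w _ /=.
  rewrite mulr_sumr; apply: eq_bigr => s _.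
  move: (M _ x) (M _ y) (M _ z) (M _ w) (A x y) (B z w) (_ ^+ s) => *.
  by ring.
rewrite pfD -[A in RHS]mulmx1 -[B in RHS]mulmx1 -[in RHS](trmx1 R 4).
rewrite -[A in RHS]mul1mx -[B in RHS]mul1mx pfD mulr_sumr.
apply: eq_bigr => x _; rewrite mulr_sumr; apply: eq_bigr => y _.
rewrite mulr_sumr; apply: eq_bigr => z _; rewrite mulr_sumr; apply: eq_bigr => w _.
by rewrite [in LHS]DE mulrCA.
Qed.

Lemma lieC A B : lie A B = - lie B A.
Proof. by rewrite /lie opprB. Qed.

Lemma lieDl A B C : lie (A + B) C = lie A C + lie B C.
Proof. by rewrite /lie mulmxDl mulmxDr opprD addrACA. Qed.

Lemma lieDr A B C : lie A (B + C) = lie A B + lie A C.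
Proof. by rewrite !(lieC A) lieDl opprD. Qed.

Lemma lieZl a A B : lie (a *: A) B = a *: lie A B.
Proof. by rewrite /lie -scalemxAl -scalemxAr scalerBr. Qed.

Lemma lieZr a A B : lie A (a *: B) = a *: lie A B.
Proof. by rewrite !(lieC A) lieZl scalerN. Qed.

Lemma liexx A : lie A A = 0.
Proof. by rewrite /lie subrr. Qed.

(** Jacobi identity in the form that ad A is a derivation; the six triple products serve as atoms
    for an entrywise linear identity. *)
Lemma lie_jacobi A B C :
  lie (lie A B) C + lie B (lie A C) = lie A (lie B C).
Proof.
rewrite /lie !mulmxBl !mulmxBr !mulmxA.
move: (A *m B *m C) (B *m A *m C) (C *m A *m B) (C *m B *m A) (B *m C *m A) (A *m C *m B).
by move=> *; apply/matrixP => i j; rewrite !mxE; ring.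
Qed.

(** Infinitesimal version of [pf_conj]: ad Z is skew for the symmetric form [pf]. It is checked on
    entries, after the lower triangle of Z is expressed through the upper one and the diagonal is
    set to 0. *)
Lemma pf_lie Z A B : Z^T = - Z -> pf (lie Z A) B = - pf A (lie Z B).
Proof.
move=> /matrixP Zskew.
have ZN i j : Z j i = - Z i j by have := Zskew i j; rewrite !mxE.
have Z0 i : Z i i = 0.
  by have /eqP := ZN i i; rewrite -addr_eq0 -mulr2n mulrn_eq0 => /eqP.
rewrite /lie !pfE !mxE !big_ord4 /=.
rewrite (ZN i1 i2) (ZN i1 i3) (ZN i1 i4) (ZN i2 i3) (ZN i2 i4) (ZN i3 i4).
rewrite !Z0.
by ring.
Qed.

(** Cyclic symmetry of the invariant trilinear form P(A, [B, C]); together with [pf_lie_swap] it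
    makes this form alternating on so(4). *)
Lemma pf_lie_rot A B C : B^T = - B -> pf A (lie B C) = pf C (lie A B).
Proof. by move=> Bsk; rewrite pfC pf_lie // -pfNr -lieC. Qed.

Lemma pf_lie_swap A B C : pf A (lie B C) = - pf A (lie C B).
Proof. by rewrite lieC pfNr. Qed.

End PfaffianForm.

(** * The forms in terms of Maurer-Cartan forms *)

Section ExplicitForms.
Variable R : realType.
Implicit Types (A B C X Z : 'M[R]_4).

(* The left and right Maurer-Cartan forms h^-1 dh and dh h^-1 of the j-th factor. *)
Definition lmc p (g v : tup p) j : 'M[R]_4 := invmx (g j) *m v j.

Definition rmc p (g v : tup p) j : 'M[R]_4 := v j *m invmx (g j).

Lemma wedgef11E p (a b : dform p 1) g (v : 'I_2 -> tup p) :
  @wedgef R p 1 1 a b g v =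
  a g (fun=> v ord0) * b g (fun=> v o1) - a g (fun=> v o1) * b g (fun=> v ord0).
Proof.
pose F m n := a g (fun=> v (inord m)) * b g (fun=> v (inord n)).
have E : (inord 0 = ord0 :> 'I_2) * (inord 1 = o1 :> 'I_2).
  by split; apply: val_inj; rewrite /= inordK.
rewrite /wedgef mul1n invr1 mul1r.
transitivity (\sum_(s : 'S_2) (-1) ^+ s * F (s ord0) (s o1)); last first.
  by rewrite sum_perm2 /F !E.
apply: eq_bigr => s _; rewrite /F !inord_val; congr (_ * (_ * _)).
  by congr a; apply/funext => i; congr (v (s _)); apply: val_inj; rewrite /= ord1.
by congr b; apply/funext => i; congr (v (s _)); apply: val_inj; rewrite /= ord1.
Qed.

Definition select2 (T : Type) (v : 'I_3 -> T) x y (i : 'I_2) : T :=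
  if i == ord0 then v x else v y.

(** The six permutations pair off by the antisymmetry of b, and each pair cancels the factor 1 / (1!
    2!) = 1/2. Antisymmetry is stated as a sign change under reversal of the two arguments. *)
Lemma wedgef12E p (a : dform p 1) (b : dform p 2) g (v : 'I_3 -> tup p) :
  (forall u, b g u = - b g (fun i => u (rev_ord i))) ->
  @wedgef R p 1 2 a b g v =
  a g (fun=> v ord0) * b g (select2 v o1 o2) - a g (fun=> v o1) * b g (select2 v ord0 o2)
  + a g (fun=> v o2) * b g (select2 v ord0 o1).
Proof.
move=> balt; set w := select2 v.
pose F m n l := a g (fun=> v (inord m)) * b g (w (inord n) (inord l)).
have E : (inord 0 = ord0 :> 'I_3) * (inord 1 = o1 :> 'I_3) * (inord 2 = o2 :> 'I_3).
  by do !split; apply: val_inj; rewrite /= inordK.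
have wC x y : b g (w x y) = - b g (w y x).
  rewrite balt; congr (- b g _); apply/funext => i; rewrite /w /select2.
  by case: (ltngtP i 0) (ltn_ord i) => //; case: i => [[|[]]].
rewrite /wedgef mul1n.
transitivity (2^-1 * \sum_(s : 'S_3) (-1) ^+ s * F (s ord0) (s o1) (s o2)); last first.
  rewrite sum_perm3 /F !E (wC o2 o1) (wC o2 ord0) (wC o1 ord0).
  by field.
congr (_ * _); apply: eq_bigr => s _; rewrite /F !inord_val; congr (_ * (_ * _)).
  by congr a; apply/funext => i; congr (v (s _)); apply: val_inj; rewrite /= ord1.
congr b; apply/funext => i; rewrite /w /select2.
have [->|i0] := eqVneq i ord0; congr (v (s _)); apply: val_inj => //=.
by case: i i0 => [[|[]]].
Qed.

Local Notation K := ((32 * pi ^+ 2)^-1 : R).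

Lemma pi_neq0 : (pi : R) != 0.
Proof. by rewrite gt_eqF // pi_gt0. Qed.

(* [field] would unfold [pi]. *)
Ltac field_pi := move: (pi : R) pi_neq0 => ? ?; by field.

(** The two summands of [E22] are P(a, b) and P(b, a); symmetry of [pf] doubles 1/64 to 1/32. *)
Lemma E22E g (v : 'I_2 -> tup 2) : @E22 R g v =
  - K * (pf (lmc g (v ord0) ord0) (rmc g (v o1) ord_max) -
         pf (lmc g (v o1) ord0) (rmc g (v ord0) ord_max)).
Proof.
transitivity (-1 / (64 * pi ^+ 2) *
  (pf (lmc g (v ord0) ord0) (rmc g (v o1) ord_max) -
   pf (lmc g (v o1) ord0) (rmc g (v ord0) ord_max) +
  (pf (rmc g (v o1) ord_max) (lmc g (v ord0) ord0) -
   pf (rmc g (v ord0) ord_max) (lmc g (v o1) ord0)))); last first.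
  rewrite ![pf (rmc _ _ _) _]pfC; field_pi.
rewrite /E22; cbv zeta; congr (_ * _).
rewrite /pf -!sumrB -big_split; apply: eq_bigr => s _ /=.
rewrite !wedgef11E ![hinv_dh _ _ _]mxE ![dh_hinv _ _ _]mxE -!/(lmc _ _ _) -!/(rmc _ _ _).
move: (s i1) (s i2) (s i3) (s i4) (_ ^+ s) => a b c d e.
move: (lmc _ (v ord0) _) (lmc _ (v o1) _) (rmc _ (v ord0) _) (rmc _ (v o1) _) => *.
by ring.
Qed.

Lemma muE X g v : @mu R X g v =
  - K * (pf X (lmc g (v ord0) ord0) + pf X (rmc g (v ord0) ord0)).
Proof.
have E (Y Z : 'M[R]_4) : \sum_(s : 'S_4) (-1) ^+ s *
    (X (s i1) (s i2) * Y (s i3) (s i4) + X (s i3) (s i4) * Z (s i1) (s i2)) =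
    pf X Y + pf Z X.
  rewrite /pf -big_split; apply: eq_bigr => s _ /=.
  by rewrite mulrDr [Z _ _ * _]mulrC.
transitivity (- (64 * pi ^+ 2)^-1 *
    (pf X (lmc g (v ord0) ord0) + pf (lmc g (v ord0) ord0) X)
  - (64 * pi ^+ 2)^-1 *
    (pf X (rmc g (v ord0) ord0) + pf (rmc g (v ord0) ord0) X)).
  rewrite -!E /mu; cbv zeta; congr (_ * _ - _ * _);
    by apply: eq_bigr => s _; rewrite !mxE.
by rewrite ![pf _ X]pfC; field_pi.
Qed.

(** On two vectors theta^2 is the commutator [theta u, theta v]. Each wedge product therefore yields
    three values of P(A, [B, C]), equal up to sign by the cyclic symmetry available on tangent
    vectors; with the two summands the constant is 6/192 = 1/32. *)
Lemma E13E g (v : 'I_3 -> tup 1) : (forall i, tangent g (v i)) -> @E13 R g v =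
  K * pf (lmc g (v ord0) ord0) (lie (lmc g (v o1) ord0) (lmc g (v o2) ord0)).
Proof.
move=> tv; pose A i := lmc g (v i) ord0.
have Ask i : so4 (A i) by exact: tv.
pose th := @hinv_dh R 1 ord0; pose th2 := mxwedge th th.
have thE x y u : th x y g u = lmc g (u ord0) ord0 x y by rewrite mxE.
have th2E x y (u : 'I_2 -> tup 1) :
    th2 x y g u = lie (lmc g (u ord0) ord0) (lmc g (u o1) ord0) x y.
  rewrite mxE /lie !mxE -sumrB; apply: eq_bigr => e _.
  by rewrite wedgef11E !thE.
have wE x y z w : wedgef (th x y) (th2 z w) g v =
    A ord0 x y * lie (A o1) (A o2) z w - A o1 x y * lie (A ord0) (A o2) z w
    + A o2 x y * lie (A ord0) (A o1) z w.
  have rev0 : rev_ord ord0 = o1 :> 'I_2 by exact: val_inj.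
  have rev1 : rev_ord o1 = ord0 :> 'I_2 by exact: val_inj.
  by rewrite wedgef12E ?thE ?th2E // => u; rewrite !th2E rev0 rev1 lieC mxE.
pose L01 := lie (A ord0) (A o1); pose L02 := lie (A ord0) (A o2).
pose L12 := lie (A o1) (A o2).
transitivity ((192 * pi ^+ 2)^-1 * \sum_(s : 'S_4) (-1) ^+ s *
    (wedgef (th (s i1) (s i2)) (th2 (s i3) (s i4)) g v +
     wedgef (th (s i3) (s i4)) (th2 (s i1) (s i2)) g v)); first by [].
transitivity ((192 * pi ^+ 2)^-1 *
  (pf (A ord0) L12 - pf (A o1) L02 + pf (A o2) L01 +
  (pf L12 (A ord0) - pf L02 (A o1) + pf L01 (A o2)))).
  congr (_ * _); rewrite /pf -!sumrB -!big_split; apply: eq_bigr => s _ /=.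
  rewrite !wE; move: (s i1) (s i2) (s i3) (s i4) (_ ^+ s) => a b c d e.
  rewrite -/L01 -/L02 -/L12; move: (A ord0) (A o1) (A o2) L01 L02 L12 => *.
  by ring.
rewrite ![pf _ (A _)]pfC (pf_lie_rot _ (A o2) (Ask o1)).
rewrite (pf_lie_rot _ (A o2) (Ask ord0)).
by rewrite pf_lie_swap lieC; field_pi.
Qed.

End ExplicitForms.

(** * Limits and derivatives of matrix-valued functions *)

Section MatrixCalculus.
Variable R : realType.

Lemma cvg_bigsum (T I : Type) (F : set_system T) (FF : Filter F) (r : seq I)
    (P : pred I) (f : I -> T -> R) (l : I -> R) :
  (forall i, f i x @[x --> F] --> l i) ->
  \sum_(i <- r | P i) f i x @[x --> F] --> \sum_(i <- r | P i) l i.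
Proof.
move=> fl; rewrite -fct_sumE.
by elim/big_ind2: _ => [|f1 l1 f2 l2|i _]; [exact: cvg_cst|exact: cvgD|exact: fl].
Qed.

Lemma cvg_bigprod (T I : Type) (F : set_system T) (FF : Filter F) (r : seq I)
    (P : pred I) (f : I -> T -> R) (l : I -> R) :
  (forall i, f i x @[x --> F] --> l i) ->
  \prod_(i <- r | P i) f i x @[x --> F] --> \prod_(i <- r | P i) l i.
Proof.
move=> fl.
have -> : (fun x => \prod_(i <- r | P i) f i x) =
    \big[(fun g h : T -> R => g \* h)/cst 1]_(i <- r | P i) f i.
  by apply/funext => x; elim/big_rec2: _ => //= i y ? Pi <-.
by elim/big_ind2: _ => [|f1 l1 f2 l2|i _]; [exact: cvg_cst|exact: cvgM|exact: fl].
Qed.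

Lemma cvg_det (T : Type) (F : set_system T) (FF : Filter F) n
    (f : T -> 'M[R]_n) (l : 'M[R]_n) :
  (forall i j, f x i j @[x --> F] --> l i j) -> \det (f x) @[x --> F] --> \det l.
Proof.
move=> fl; apply: cvg_bigsum => s; apply: cvgM; first exact: cvg_cst.
by apply: cvg_bigprod => i; exact: fl.
Qed.

Lemma cvg_mulmx (T : Type) (F : set_system T) (FF : Filter F) m n p
    (f : T -> 'M[R]_(m, n)) (g : T -> 'M[R]_(n, p)) (l : 'M[R]_(m, n)) (l' : 'M[R]_(n, p)) :
  (forall i j, f x i j @[x --> F] --> l i j) ->
  (forall i j, g x i j @[x --> F] --> l' i j) ->
  forall i j, (f x *m g x) i j @[x --> F] --> (l *m l') i j.
Proof.
move=> fl gl i j; rewrite !mxE; under eq_fun do rewrite mxE.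
by apply: cvg_bigsum => k; apply: cvgM.
Qed.

Lemma near_unitmx (T : Type) (F : set_system T) (FF : Filter F) n
    (f : T -> 'M[R]_n) (l : 'M[R]_n) :
  (forall i j, f x i j @[x --> F] --> l i j) -> l \in unitmx ->
  \forall x \near F, f x \in unitmx.
Proof.
move=> fl; rewrite unitmxE unitfE => l0.
by apply: filterS (cvgr_neq0 _ (cvg_det _ fl) l0) => x; rewrite unitmxE unitfE.
Qed.

(** By Cramer's rule the inverse is a quotient of polynomials in the entries. Since [invmx] is
    defined by cases, the formula is used only near the limit, where the determinant stays
    nonzero. *)
Lemma cvg_invmx (T : Type) (F : set_system T) (FF : Filter F) n
    (f : T -> 'M[R]_n) (l : 'M[R]_n) :
  (forall i j, f x i j @[x --> F] --> l i j) -> l \in unitmx ->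
  forall i j, invmx (f x) i j @[x --> F] --> invmx l i j.
Proof.
move=> fl lu i j.
have -> : invmx l i j = (\det l)^-1 * cofactor l j i by rewrite /invmx lu !mxE.
have fE : \forall x \near F, (\det (f x))^-1 * cofactor (f x) j i = invmx (f x) i j.
  by apply: filterS (near_unitmx _ fl lu) => x fu; rewrite /invmx fu !mxE.
apply: cvg_trans (near_eq_cvg fE) _.
apply: cvgM.
  by apply: cvgV; [move: lu; rewrite unitmxE unitfE|exact: cvg_det].
apply: cvgM; first exact: cvg_cst.
by apply: cvg_det => a b; rewrite !mxE; under eq_fun do rewrite !mxE; exact: fl.
Qed.

Lemma is_derive_mxP m n (F : R -> 'M[R]_(m, n)) (t : R) dF :
  is_derive t 1 F dF <-> forall i j, is_derive t 1 (fun x => F x i j) (dF i j).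
Proof.
split=> [[dFt <-] i j|dFt].
  by rewrite derive_mx // mxE; apply: derivableP; move/derivable_mxP : dFt; exact.
have dF' : derivable F t 1 by apply/derivable_mxP => i j; have [] := dFt i j.
apply: DeriveDef => //; rewrite derive_mx //.
by apply/matrixP => i j; rewrite mxE; have [] := dFt i j.
Qed.

Lemma is_derive_bigsum (I : Type) (r : seq I) (P : pred I) (f : I -> R -> R)
    (df : I -> R) (t : R) :
  (forall i, is_derive t 1 (f i) (df i)) ->
  is_derive t 1 (fun x => \sum_(i <- r | P i) f i x) (\sum_(i <- r | P i) df i).
Proof.
move=> fl; rewrite -fct_sumE.
by elim/big_ind2: _ => [|f1 l1 f2 l2 ? ?|i _];
  [exact: is_derive_cst|exact: is_deriveD|exact: fl].
Qed.

Lemma is_derive_mul (f g : R -> R) (df dg t : R) :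
  is_derive t 1 f df -> is_derive t 1 g dg ->
  is_derive t 1 (fun x => f x * g x) (df * g t + f t * dg).
Proof.
move=> fd gd; have /= := is_deriveM fd gd.
by move/is_derive_eq; apply; rewrite addrC; congr (_ + _); exact: mulrC.
Qed.

Lemma is_derive_mulmx m n p (F : R -> 'M[R]_(m, n)) (G : R -> 'M[R]_(n, p)) dF dG (t : R) :
  is_derive t 1 F dF -> is_derive t 1 G dG ->
  is_derive t 1 (fun x => F x *m G x) (dF *m G t + F t *m dG).
Proof.
move=> /is_derive_mxP Fd /is_derive_mxP Gd; apply/is_derive_mxP => i j.
rewrite !mxE -big_split /=; under eq_fun do rewrite mxE.
by apply: is_derive_bigsum => k; apply: is_derive_mul.
Qed.

Lemma is_derive_trmx m n (F : R -> 'M[R]_(m, n)) dF (t : R) :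
  is_derive t 1 F dF -> is_derive t 1 (fun x => (F x)^T) dF^T.
Proof.
move=> /is_derive_mxP Fd; apply/is_derive_mxP => i j.
by rewrite mxE; under eq_fun do rewrite mxE.
Qed.

(** For small h the difference quotient of the inverse is - F(t+h)^-1 ((F(t+h) - F(t)) / h) F(t)^-1;
    the limit follows from continuity of inversion. *)
Lemma is_derive_invmx n (F : R -> 'M[R]_n) dF (t : R) :
  is_derive t 1 F dF -> F t \in unitmx ->
  is_derive t 1 (fun x => invmx (F x)) (- (invmx (F t) *m dF *m invmx (F t))).
Proof.
move=> /is_derive_mxP Fd Ftu; pose G0 : set_system R := (0 : R)^'.
have G0F : Filter G0 by exact: dnbhs_filter.
have Fcvg i j : F (h *: 1 + t) i j @[h --> G0] --> F t i j.
  have [Fij _] := Fd i j.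
  have /differentiable_continuous Fc : differentiable (fun x => F x i j) t.
    exact/derivable1_diffP.
  have h0 : h *: 1 + t @[h --> G0] --> t.
    rewrite -[X in _ --> X]add0r; apply: cvgD; last exact: cvg_cst.
    have -> : (fun h : R => h *: (1 : R)) = id by apply/funext => h; exact: mulr1.
    exact: cvg_within.
  exact: (cvg_comp _ _ h0 Fc).
have Funit := near_unitmx G0F Fcvg Ftu.
have quot i j : h^-1 *: (F (h *: 1 + t) - F t) i j @[h --> G0] --> dF i j.
  have [Fij <-] := Fd i j; under eq_fun do rewrite !mxE; exact: Fij.
suff lim i j : h^-1 *: (invmx (F (h *: 1 + t)) i j - invmx (F t) i j) @[h --> G0] -->
    (- (invmx (F t) *m dF *m invmx (F t))) i j.
  apply/is_derive_mxP => i j; apply: DeriveDef; first by apply: cvgP; exact: lim.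
  by apply: cvg_lim => //; exact: lim.
pose M h := invmx (F (h *: 1 + t)) *m (h^-1 *: (F (h *: 1 + t) - F t)) *m invmx (F t).
have Mcvg : M h i j @[h --> G0] --> (invmx (F t) *m dF *m invmx (F t)) i j.
  apply: cvg_mulmx => a b; last exact: cvg_cst.
  apply: cvg_mulmx => c d; first exact: cvg_invmx.
  by under eq_fun do rewrite mxE; exact: quot.
have E : {near G0, (fun h => - M h i j) =1
    (fun h => h^-1 *: (invmx (F (h *: 1 + t)) i j - invmx (F t) i j))}.
  apply: filterS Funit => h Fu; rewrite /M -scalemxAr -scalemxAl mulmxBr mulVmx //.
  by rewrite mulmxBl mul1mx -mulmxA mulmxV // mulmx1 !mxE -mulrN opprB.
rewrite mxE; exact: cvg_trans (near_eq_cvg E) (cvgN Mcvg).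
Qed.

Lemma is_derive_pf (F G : R -> 'M[R]_4) dF dG (t : R) :
  is_derive t 1 F dF -> is_derive t 1 G dG ->
  is_derive t 1 (fun x => pf (F x) (G x)) (pf dF (G t) + pf (F t) dG).
Proof.
move=> /is_derive_mxP Fd /is_derive_mxP Gd; rewrite /pf -big_split /=.
apply: is_derive_bigsum => s; rewrite -mulrDr.
have := is_derive_mul (is_derive_cst _ _ _)
  (is_derive_mul (Fd (s i1) (s i2)) (Gd (s i3) (s i4))).
by move=> /(_ ((-1) ^+ s)) /= /is_derive_eq; apply; rewrite mul0r add0r.
Qed.

Lemma is_derive_line m n (A C : 'M[R]_(m, n)) (t : R) :
  is_derive t 1 (fun x : R => A + x *: C) C.
Proof.
apply/is_derive_mxP => i j; under eq_fun do rewrite !mxE.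
have := is_deriveD (is_derive_cst (A i j) t 1)
  (is_derive_mul (is_derive_id t 1) (is_derive_cst (C i j) t 1)).
by move=> /is_derive_eq; apply; rewrite /cst /= mulr0 addr0 mul1r add0r.
Qed.

End MatrixCalculus.

(** * Cayley charts *)

Section CayleyChart.
Variable R : realType.
Implicit Types A C g X : 'M[R]_4.

(* [chart g A] is g (1 + A/2) (cay A). *)
Definition cay A := invmx (1%:M - 2^-1 *: A).

(** A row vector v in the kernel satisfies v = vA/2, so v v^T = (v A v^T)/2. The 1 x 1 matrix v A
    v^T is skew, hence 0, and the sum of squares v v^T forces v = 0. *)
Lemma skew_unitmx A : so4 A -> 1%:M - 2^-1 *: A \in unitmx.
Proof.
move=> Ask; rewrite unitmxE unitfE; apply/det0P => -[v /eqP v0 vA]; apply: v0.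
have vE : v = 2^-1 *: (v *m A).
  by apply/eqP; rewrite -subr_eq0 scalemxAr -[X in X - _](mulmx1 v) -mulmxBr vA.
have vAv : v *m A *m v^T = 0.
  have : (v *m A *m v^T)^T = - (v *m A *m v^T).
    by rewrite !trmx_mul trmxK Ask mulNmx mulmxN mulmxA.
  move/matrixP => skew; apply/matrixP => i j; rewrite !ord1 [RHS]mxE.
  have := skew ord0 ord0; rewrite [LHS]mxE [RHS]mxE => /eqP.
  by rewrite -addr_eq0 -mulr2n mulrn_eq0 => /eqP.
have : v *m v^T = 0 by rewrite {1}vE -scalemxAl vAv scaler0.
move/matrixP/(_ ord0 ord0); rewrite !mxE => /eqP.
under eq_bigr do rewrite mxE -expr2.
rewrite psumr_eq0 => [/allP vi0|i _]; last exact: sqr_ge0.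
apply/matrixP => i j; rewrite ord1 mxE.
by have := vi0 j (mem_index_enum j); rewrite implyTb sqrf_eq0 => /eqP.
Qed.

Lemma trmx_cay A : so4 A -> (cay A)^T = invmx (1%:M + 2^-1 *: A).
Proof.
by move=> Ask; rewrite trmx_inv linearB linearZ /= trmx1 Ask scalerN opprK.
Qed.

Lemma skew_unitmxD A : so4 A -> 1%:M + 2^-1 *: A \in unitmx.
Proof.
move=> Ask; have := skew_unitmx Ask.
by rewrite -unitmx_tr linearB linearZ /= trmx1 Ask scalerN opprK.
Qed.

Lemma cayE A : so4 A -> (1%:M + 2^-1 *: A) *m cay A = 2 *: cay A - 1%:M.
Proof.
move=> Ask.
have -> : 1%:M + 2^-1 *: A = 2 *: 1%:M - (1%:M - 2^-1 *: A).
  by rewrite scaler_nat mulr2n opprB -addrA addrCA subrr addr0 addrC.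
by rewrite mulmxBl -scalemxAl mul1mx mulmxV // skew_unitmx.
Qed.

Lemma cay_comm A : (1%:M - 2^-1 *: A) *m (1%:M + 2^-1 *: A) =
  (1%:M + 2^-1 *: A) *m (1%:M - 2^-1 *: A).
Proof.
rewrite mulmxBl mulmxDl !mulmxBr !mulmxDr !mul1mx !mulmx1 opprD.
by rewrite [LHS]addrA [RHS]addrA addrK subrK.
Qed.

Lemma cay_commV A : so4 A ->
  (1%:M + 2^-1 *: A) *m cay A = cay A *m (1%:M + 2^-1 *: A).
Proof.
move=> /skew_unitmx Mu; apply: (can_inj (mulKmx Mu)).
by rewrite mulmxA cay_comm mulmxK // mulKVmx.
Qed.

Lemma SO4_unit g : SO4 g -> g \in unitmx.
Proof. by case=> + _ => /mulmx1_unit []. Qed.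

Lemma SO4_inv g : SO4 g -> invmx g = g^T.
Proof.
move=> gS; have [gg _] := gS.
by rewrite -[g^T]mulmx1 -(mulmxV (SO4_unit gS)) mulmxA gg mul1mx.
Qed.

Lemma SO4_trmx g : SO4 g -> SO4 g^T.
Proof.
move=> gS; have [gg gd] := gS; split; last by rewrite det_tr.
by rewrite trmxK -(SO4_inv gS) mulmxV // SO4_unit.
Qed.

Lemma SO4_mul g h : SO4 g -> SO4 h -> SO4 (g *m h).
Proof.
move=> [gg gd] [hh hd]; split; last by rewrite det_mulmx gd hd mulr1.
by rewrite trmx_mul mulmxA -(mulmxA h^T) gg mulmx1.
Qed.

Lemma so4_conj g A : so4 A -> so4 (g *m A *m g^T).
Proof.
by move=> Ask; rewrite /so4 !trmx_mul trmxK Ask mulNmx mulmxN mulmxA.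
Qed.

Lemma pf_SO4 g A C : SO4 g -> pf (g *m A *m g^T) (g *m C *m g^T) = pf A C.
Proof. by case=> _ gd; rewrite pf_conj gd mul1r. Qed.

(** The Cayley transform is orthogonal because 1 + A/2 and 1 - A/2 commute, and has determinant 1
    because they are transposes of each other. *)
Lemma chart_SO4 g A : SO4 g -> so4 A ->
  SO4 (g *m (1%:M + 2^-1 *: A) *m cay A).
Proof.
move=> gS Ask; rewrite -mulmxA; apply: SO4_mul => //; split.
  rewrite trmx_mul trmx_cay // linearD linearZ /= trmx1 Ask scalerN.
  rewrite mulmxA -(mulmxA (invmx _)) cay_comm mulmxA mulVmx ?skew_unitmxD // mul1mx.
  by rewrite mulmxV // skew_unitmx.
rewrite det_mulmx /cay det_inv -det_tr linearD linearZ /= trmx1 Ask scalerN.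
by rewrite divff // -unitfE -unitmxE skew_unitmx.
Qed.

Lemma is_derive_cay A C (t : R) : 1%:M - 2^-1 *: (A + t *: C) \in unitmx ->
  is_derive t 1 (fun x => cay (A + x *: C))
    (2^-1 *: (cay (A + t *: C) *m C *m cay (A + t *: C))).
Proof.
move=> Au.
have Fd : is_derive t 1 (fun x : R => 1%:M - 2^-1 *: (A + x *: C)) (- (2^-1 *: C)).
  have -> : (fun x : R => 1%:M - 2^-1 *: (A + x *: C)) =
      (fun x => (1%:M - 2^-1 *: A) + x *: (- (2^-1 *: C))).
    apply/funext => x; rewrite scalerDr opprD addrA scalerN.
    by rewrite !scalerA [x * _]mulrC.
  exact: is_derive_line.
apply: is_derive_eq; first exact: is_derive_invmx Fd Au.
by rewrite mulmxN mulNmx opprK -scalemxAr -scalemxAl.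
Qed.

End CayleyChart.

(** * Maurer-Cartan forms in Cayley charts *)

Section ChartPullback.
Variable R : realType.
Implicit Types p q k : nat.
Local Notation tupR := (@tup R).

Lemma tmapE p q (f : tupR p -> tupR q) g v j (D : 'M[R]_4) :
  is_derive (0 : R) 1 (fun t : R => f (g + t *: v) j) D -> tmap f g v j = D.
Proof. by move=> fD; rewrite /tmap derive1E derive_val. Qed.

Lemma is_derive_tup p (g v : tupR p) j :
  is_derive (0 : R) 1 (fun t => (g + t *: v) j) (v j).
Proof. exact: is_derive_line. Qed.

Lemma tupD0 p (g v : tupR p) j : (g + (0 : R) *: v) j = g j.
Proof. by rewrite scale0r addr0. Qed.

Lemma skews_line p (A C : tupR p) (t : R) : skews A -> skews C -> skews (A + t *: C).
Proof.
move=> As Cs j; have := As j; have := Cs j; rewrite /so4 => Cj Aj.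
have -> : (A + t *: C) j = A j + t *: C j by [].
by rewrite linearD linearZ /= Aj Cj scalerN opprD.
Qed.

Lemma skews0 p : skews (0 : tupR p).
Proof. by move=> j; rewrite /so4 oppr0 trmx0. Qed.

Lemma is_derive_cay_tup p (A C : tupR p) j : skews A ->
  is_derive (0 : R) 1 (fun t => cay ((A + t *: C) j))
    (2^-1 *: (cay (A j) *m C j *m cay (A j))).
Proof.
move=> As; have := @is_derive_cay R (A j) (C j) 0.
rewrite scale0r addr0; apply; exact: skew_unitmx.
Qed.

Lemma chart_NG p (g A : tupR p) : NG g -> skews A -> NG (chart g A).
Proof. by move=> gS As j; apply: chart_SO4. Qed.

Lemma tmap_chart p (g A C : tupR p) j : skews A ->
  tmap (chart g) A C j = g j *m cay (A j) *m C j *m cay (A j).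
Proof.
move=> As; apply: tmapE.
have D1 : is_derive (0 : R) 1 (fun t => 1%:M + 2^-1 *: (A + t *: C) j) (2^-1 *: C j).
  have -> : (fun t : R => 1%:M + 2^-1 *: (A + t *: C) j) =
      (fun t => (1%:M + 2^-1 *: A j) + t *: (2^-1 *: C j)).
    apply/funext => t; have -> : (A + t *: C) j = A j + t *: C j by [].
    by rewrite scalerDr addrA !scalerA [t * _]mulrC.
  exact: is_derive_line.
have D2 : is_derive (0 : R) 1 (fun t : R => chart g (A + t *: C) j) _ :=
  is_derive_mulmx (is_derive_mulmx (is_derive_cst (g j) (0 : R) 1) D1)
    (is_derive_cay_tup C j As).
apply: (is_derive_eq D2); rewrite /cst tupD0 mul0mx add0r.
move: (1%:M + _) (cay _) (cayE (As j)) => P N PN.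
transitivity (g j *m ((1%:M + P *m N) *m (2^-1 *: C j) *m N)).
  by rewrite !mulmxDl mul1mx mulmxDr -!scalemxAr -!scalemxAl -!scalemxAr !mulmxA.
(* [PN] turns 1 + P N into 2 N, and this 2 cancels the factor 1/2 of C. *)
rewrite PN (addrC 1%:M) subrK -!scalemxAr -!scalemxAl -!scalemxAr scalerA.
by rewrite mulVf ?pnatr_eq0 // scale1r !mulmxA.
Qed.

Lemma lmc_chart p (g A C : tupR p) j : NG g -> skews A ->
  lmc (chart g A) (tmap (chart g) A C) j = (cay (A j))^T *m C j *m cay (A j).
Proof.
move=> gS As; apply: (can_inj (mulKmx (SO4_unit (chart_NG gS As j)))).
rewrite mulKVmx ?tmap_chart ?trmx_cay //; last exact/SO4_unit/chart_NG.
rewrite /chart -/(cay _) !mulmxA; congr (_ *m _ *m _).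
(* With N = cay A and P = 1 + A/2: N^T = P^-1 and P N = N P, so the point g P N times N^T is g N. *)
rewrite -[in RHS](mulmxA (g j)) cay_commV // mulmxA mulmxK //.
exact: skew_unitmxD.
Qed.

Lemma rmc_chart p (g A C : tupR p) j : NG g -> skews A ->
  rmc (chart g A) (tmap (chart g) A C) j =
    g j *m cay (A j) *m C j *m (cay (A j))^T *m (g j)^T.
Proof.
move=> gS As; apply: (can_inj (mulmxK (SO4_unit (chart_NG gS As j)))).
rewrite mulmxKV ?tmap_chart ?trmx_cay //; last exact/SO4_unit/chart_NG.
rewrite -(SO4_inv (gS j)) /chart -/(cay _) !mulmxA mulmxKV ?SO4_unit //.
by rewrite mulmxKV // skew_unitmxD.
Qed.

Lemma tangent_chart p (g A C : tupR p) : NG g -> skews A -> skews C ->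
  tangent (chart g A) (tmap (chart g) A C).
Proof.
move=> gS As Cs j; rewrite -/(lmc _ _ _) lmc_chart // -{2}[cay _]trmxK.
exact: so4_conj.
Qed.

End ChartPullback.

(** * Smoothness of the coefficients *)

Section Smoothness.
Variable R : realType.
Local Notation tupR := (@tup R).

(* In a Cayley chart the coefficients of the forms below are polynomials in the
   entries of the [cay (A j)]; these polynomials are stable under directional
   derivatives because the derivative of [cay] along C is [cay A * (C/2) * cay A]. *)
Inductive cayley_poly p : (tupR p -> R) -> Prop :=
| cayley_cst c : cayley_poly (fun=> c)
| cayley_entry j a b : cayley_poly (fun A => cay (A j) a b)
| cayley_add f g : cayley_poly f -> cayley_poly g -> cayley_poly (fun A => f A + g A)
| cayley_mul f g : cayley_poly f -> cayley_poly g -> cayley_poly (fun A => f A * g A).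

Lemma cayley_sum p (I : Type) (r : seq I) (P : pred I) (f : I -> tupR p -> R) :
  (forall i, cayley_poly (f i)) -> cayley_poly (fun A => \sum_(i <- r | P i) f i A).
Proof.
move=> fP; rewrite -fct_sumE; elim/big_ind: _ => [|g h|i _]; last exact: fP.
  exact: cayley_cst.
exact: cayley_add.
Qed.

Definition cayley_mx p m n (F : tupR p -> 'M[R]_(m, n)) :=
  forall i j, cayley_poly (fun A => F A i j).

Lemma cayley_mx_cst p m n (M : 'M[R]_(m, n)) : cayley_mx (fun _ : tupR p => M).
Proof. by move=> i j; exact: cayley_cst. Qed.

Lemma cayley_mx_cay p (j : 'I_p) : cayley_mx (fun A : tupR p => cay (A j)).
Proof. by move=> a b; exact: cayley_entry. Qed.

Lemma cayley_mx_tr p m n (F : tupR p -> 'M[R]_(m, n)) :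
  cayley_mx F -> cayley_mx (fun A => (F A)^T).
Proof. by move=> FP i j; under eq_fun do rewrite mxE. Qed.

Lemma cayley_mx_mul p m n q (F : tupR p -> 'M[R]_(m, n)) (G : tupR p -> 'M[R]_(n, q)) :
  cayley_mx F -> cayley_mx G -> cayley_mx (fun A => F A *m G A).
Proof.
move=> FP GP i j; under eq_fun do rewrite mxE.
by apply: cayley_sum => k; apply: cayley_mul.
Qed.

Lemma cayley_mx_lie p (F G : tupR p -> 'M[R]_4) :
  cayley_mx F -> cayley_mx G -> cayley_mx (fun A => lie (F A) (G A)).
Proof.
move=> FP GP i j; under eq_fun do rewrite !mxE -sumrB.
by apply: cayley_sum => k; apply: cayley_add; [|under eq_fun do rewrite -mulN1r;
  apply: cayley_mul; first exact: cayley_cst]; apply: cayley_mul.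
Qed.

Lemma cayley_pf p (F G : tupR p -> 'M[R]_4) :
  cayley_mx F -> cayley_mx G -> cayley_poly (fun A => pf (F A) (G A)).
Proof.
move=> FP GP; apply: cayley_sum => s; apply: cayley_mul; first exact: cayley_cst.
exact: cayley_mul.
Qed.

(** Stated for an arbitrary filter with entrywise convergence, which is what the product topology of
    [ptws] supplies. *)
Lemma cayley_cvg p (f : tupR p -> R) (F : set_system (tupR p)) (A : tupR p) :
  Filter F -> (forall j a b, (fun B : tupR p => B j a b) @ F --> A j a b) -> skews A ->
  cayley_poly f -> f B @[B --> F] --> f A.
Proof.
move=> FF FA As; elim=> [c|j a b|g h _ gF _ hF|g h _ gF _ hF].
- exact: cvg_cst.
- apply: cvg_invmx => [x y|]; last exact: skew_unitmx.
  have E (B : 'M[R]_4) : (1%:M - 2^-1 *: B) x y = (x == y)%:R - 2^-1 * B x y.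
    by rewrite !mxE.
  under eq_fun do rewrite E; rewrite E.
  exact: (cvgB (cvg_cst _) (cvgM (cvg_cst _) (FA j x y))).
- exact: cvgD.
- exact: cvgM.
Qed.

Lemma cayley_continuous p (f : tupR p -> R) : cayley_poly f ->
  {within (@skews R p : set {ptws 'I_p -> 'M[R]_4}),
    continuous (f : {ptws 'I_p -> 'M[R]_4} -> R)}.
Proof.
move=> fP; apply: continuous_in_subspaceT => A; rewrite inE => As.
apply: (@cayley_cvg p f _ A (@nbhs_filter {ptws 'I_p -> 'M[R]_4} A)) => // j a b.
exact: (cvg_comp _ _ (@proj_continuous _ _ j A) (@coord_continuous _ _ _ a b (A j))).
Qed.

(** Induction with the Leibniz rule. A single f' serves all base points, so that the statement can
    be iterated. *)
Lemma cayley_derive p (f : tupR p -> R) (C : tupR p) : cayley_poly f ->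
  exists2 f', cayley_poly f' &
    forall A, skews A -> is_derive (0 : R) 1 (fun t => f (A + t *: C)) (f' A).
Proof.
elim=> [c|j a b|g h gP [g' g'P gg'] hP [h' h'P hh']|g h gP [g' g'P gg'] hP [h' h'P hh']].
- by exists (fun=> 0) => [|A _]; [exact: cayley_cst|exact: is_derive_cst].
- exists (fun A => (2^-1 *: (cay (A j) *m C j *m cay (A j))) a b) => [|A As].
    under eq_fun do rewrite mxE; apply: cayley_mul; first exact: cayley_cst.
    apply: cayley_mx_mul; last exact: cayley_mx_cay.
    by apply: cayley_mx_mul; [exact: cayley_mx_cay|exact: cayley_mx_cst].
  by have /is_derive_mxP := is_derive_cay_tup C j As; exact.
- exists (fun A => g' A + h' A) => [|A As]; first exact: cayley_add.
  exact: is_deriveD (gg' A As) (hh' A As).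
exists (fun A => g' A * h A + g A * h' A) => [|A As].
  by apply: cayley_add; apply: cayley_mul.
have := is_derive_mul (gg' A As) (hh' A As).
by rewrite scale0r addr0.
Qed.

(** Agreement on skew tuples suffices, since [Cn] reads f only there and lines with skew direction
    stay inside so(4)^p. *)
Lemma cayley_smooth p (f g : tupR p -> R) : cayley_poly g ->
  (forall A, skews A -> f A = g A) -> smooth f.
Proof.
move=> gP fg n; elim: n f g gP fg => [|n IH] f g gP fg.
  split=> //=; apply: (subspace_eq_continuous _ (cayley_continuous gP)) => A.
  by rewrite inE => As; exact/esym/fg.
(* Every [Cn] contains the same continuity clause, so it is extracted from the induction
   hypothesis. *)
split; first by have := IH f g gP fg; case: (n) => [|m] [].
move=> C Cs; have [g' g'P gg'] := cayley_derive C gP.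
have fgt A : skews A -> (fun t : R => f (A + t *: C)) = (fun t => g (A + t *: C)).
  by move=> As; apply/funext => t; apply/fg/skews_line.
split=> [A As|]; first by rewrite fgt //; have [] := gg' A As.
apply: (IH _ g') => // A As; rewrite fgt //.
by rewrite derive1E; have [] := gg' A As.
Qed.

End Smoothness.

(** * Multilinearity, alternation and smoothness of the given forms *)

Section Forms.
Variable R : realType.
Local Notation tupR := (@tup R).
Local Notation K := ((32 * pi ^+ 2)^-1 : R).

Hint Resolve cayley_cst cayley_add cayley_mul cayley_mx_cst cayley_mx_cay
  cayley_mx_tr cayley_mx_mul cayley_mx_lie cayley_pf : cayley.

Lemma lmcP p a (g u u' : tupR p) j : lmc g (a *: u + u') j = a *: lmc g u j + lmc g u' j.
Proof. by rewrite [LHS]mulmxDr -scalemxAr. Qed.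

Lemma rmcP p a (g u u' : tupR p) j : rmc g (a *: u + u') j = a *: rmc g u j + rmc g u' j.
Proof. by rewrite [LHS]mulmxDl -scalemxAl. Qed.

Lemma tangent_dfwith p k (g : tupR p) (v : 'I_k -> tupR p) i u :
  (forall j, tangent g (v j)) -> tangent g u -> forall j, tangent g (dfwith v i u j).
Proof.
by move=> gv gu j; have [<-|ij] := eqVneq i j; rewrite ?dfwithin ?dfwithout.
Qed.

Lemma tangentZD p (g u u' : tupR p) a : tangent g u -> tangent g u' ->
  tangent g (a *: u + u').
Proof.
move=> gu gu' j; rewrite -[_ *m _]/(lmc g (a *: u + u') j) lmcP /so4.
by rewrite linearD linearZ /= gu gu' scalerN opprD.
Qed.

Lemma is_form_zero p k : is_form (@zerof R p k).
Proof.
split=> // [*|g C gS Cs]; first by rewrite /zerof mulr0 addr0.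
by apply: cayley_smooth => //; exact: cayley_cst.
Qed.

Lemma is_form_mu X : is_form (@mu R X).
Proof.
split=> [g v i u u' a _ _ _ _|g v i j|g C gS Cs].
- rewrite (ord1 i) !muE !dfwithin lmcP rmcP !pfDr !pfZr; ring.
- by rewrite !ord1 eqxx.
apply: (@cayley_smooth R 1 _ (fun A => - K *
    (pf X ((cay (A ord0))^T *m C ord0 ord0 *m cay (A ord0)) +
     pf X (g ord0 *m cay (A ord0) *m C ord0 ord0 *m (cay (A ord0))^T *m (g ord0)^T)))).
  by auto 10 with cayley.
by move=> A As; rewrite /pullback muE lmc_chart // rmc_chart.
Qed.

Lemma is_form_E22 : is_form (@E22 R).
Proof.
split=> [g v i u u' a _ _ _ _|g v i j _ _|g C gS Cs].
- have [->|->] := ord2P i.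
    rewrite !E22E !dfwithin !(@dfwithout _ _ _ _ _ o1) // !lmcP !rmcP.
    by rewrite !(pfDl, pfDr, pfZl, pfZr); ring.
  rewrite !E22E !dfwithin !(@dfwithout _ _ _ _ _ ord0) // !lmcP !rmcP.
  by rewrite !(pfDl, pfDr, pfZl, pfZr); ring.
- by have [->|->] := ord2P i; have [->|->] := ord2P j => // _;
    rewrite E22E => ->; rewrite subrr mulr0.
pose L i (A : tupR 2) := (cay (A ord0))^T *m C i ord0 *m cay (A ord0).
pose M i (A : tupR 2) := g ord_max *m cay (A ord_max) *m C i ord_max *m
  (cay (A ord_max))^T *m (g ord_max)^T.
(* The difference is written with a factor -1 because [cayley_poly] is generated by sums and
   products. *)
apply: (@cayley_smooth R 2 _ (fun A => - K *
    (pf (L ord0 A) (M o1 A) + -1 * pf (L o1 A) (M ord0 A)))).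
  by rewrite /L /M; auto 12 with cayley.
move=> A As.
have LE i : lmc (chart g A) (tmap (chart g) A (C i)) ord0 = L i A by exact: lmc_chart.
have ME i : rmc (chart g A) (tmap (chart g) A (C i)) ord_max = M i A by exact: rmc_chart.
by rewrite -!LE -!ME mulN1r; exact: E22E.
Qed.

Lemma is_form_E13 : is_form (@E13 R).
Proof.
split=> [g v i u u' a gS vg gu gu'|g v i j gS vg|g C gS Cs].
- rewrite !E13E; do ?[by apply: tangent_dfwith => //; exact: tangentZD].
  have [->|->|->] := ord3P i.
  + rewrite !dfwithin !(@dfwithout _ _ _ _ _ o1) // !(@dfwithout _ _ _ _ _ o2) //.
    rewrite !lmcP pfDl pfZl; ring.
  + rewrite !dfwithin !(@dfwithout _ _ _ _ _ ord0) // !(@dfwithout _ _ _ _ _ o2) //.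
    rewrite !lmcP lieDl lieZl pfDr pfZr; ring.
  + rewrite !dfwithin !(@dfwithout _ _ _ _ _ ord0) // !(@dfwithout _ _ _ _ _ o1) //.
    rewrite !lmcP lieDr lieZr pfDr pfZr; ring.
- have vsk l : so4 (lmc g (v l) ord0) by exact: vg.
  rewrite E13E // => ij vij.
  (* Alternation reduces to three coincidences of arguments; rotation and swap move the equal pair
     into the bracket, where it vanishes. *)
  suff [E|E|E] : [\/ v ord0 = v o1, v o1 = v o2 | v ord0 = v o2].
  + by rewrite E (pf_lie_rot _ _ (vsk _)) liexx pf0r mulr0.
  + by rewrite E liexx pf0r mulr0.
  + by rewrite E pf_lie_swap (pf_lie_rot _ _ (vsk _)) liexx pf0r oppr0 mulr0.
  have [Ei|Ei|Ei] := ord3P i; have [Ej|Ej|Ej] := ord3P j;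
    move: ij vij; rewrite Ei Ej // => _ vij;
    first [by constructor 1 | by constructor 2 | by constructor 3].
pose L i (A : tupR 1) := (cay (A ord0))^T *m C i ord0 *m cay (A ord0).
apply: (@cayley_smooth R 1 _ (fun A => K * pf (L ord0 A) (lie (L o1 A) (L o2 A)))).
  by rewrite /L; auto 12 with cayley.
move=> A As.
have LE i : lmc (chart g A) (tmap (chart g) A (C i)) ord0 = L i A by exact: lmc_chart.
rewrite -!LE; apply: E13E => i; exact: tangent_chart.
Qed.

(** * Structure equations at the centre of a chart *)

Lemma cay0 : cay 0 = 1%:M :> 'M[R]_4.
Proof. by rewrite /cay scaler0 subr0 invmx1. Qed.

(** At the centre N' = C/2 and (N^T)' = - C/2, so N^T D N has derivative - [C, D]/2. Antisymmetrised
    in C and D this is d theta = - theta^2. *)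
Lemma is_derive_lmc_chart p (g C D : tupR p) j : NG g -> skews C ->
  is_derive (0 : R) 1
    (fun t => lmc (chart g (0 + t *: C)) (tmap (chart g) (0 + t *: C) D) j)
    (- 2^-1 *: lie (C j) (D j)).
Proof.
move=> gS Cs.
under eq_fun => t do rewrite (lmc_chart _ _ gS (skews_line _ (@skews0 R p) Cs)).
have cC := is_derive_cay_tup C j (@skews0 R p).
have := is_derive_mulmx (is_derive_mulmx (is_derive_trmx cC) (is_derive_cst (D j) _ _)) cC.
move/is_derive_eq; apply; rewrite /cst tupD0 [(0 : tupR p) j]/(0 : 'M[R]_4) cay0.
rewrite trmx1 !mul1mx !mulmx1 addr0 linearZ /= Cs /lie.
by rewrite -scalemxAr -scalemxAl mulNmx scaleNr scalerBr opprB addrC scalerN.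
Qed.

(** The same computation for g N D N^T g^T; antisymmetrised it gives d rho = rho^2. *)
Lemma is_derive_rmc_chart p (g C D : tupR p) j : NG g -> skews C ->
  is_derive (0 : R) 1
    (fun t => rmc (chart g (0 + t *: C)) (tmap (chart g) (0 + t *: C) D) j)
    (2^-1 *: (g j *m lie (C j) (D j) *m (g j)^T)).
Proof.
move=> gS Cs.
under eq_fun => t do rewrite (rmc_chart _ _ gS (skews_line _ (@skews0 R p) Cs)).
have cC := is_derive_cay_tup C j (@skews0 R p).
have := is_derive_mulmx (is_derive_mulmx (is_derive_mulmx (is_derive_mulmx
  (is_derive_cst (g j) _ _) cC) (is_derive_cst (D j) _ _))
  (is_derive_trmx cC)) (is_derive_cst (g j)^T _ _).
move/is_derive_eq; apply; rewrite /cst tupD0 [(0 : tupR p) j]/(0 : 'M[R]_4) cay0.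
rewrite trmx1 !mul1mx !mulmx1 !mulmx0 !addr0 add0r [(_ *: C j)^T]linearZ /= Cs /lie.
by rewrite scalerN mulmxN -!scalemxAr -!scalemxAl -scalerBr -!scalemxAl mulmxBr !mulmxA.
Qed.

End Forms.

(** * Exterior derivatives *)

Section ExteriorDerivatives.
Variable R : realType.
Local Notation tupR := (@tup R).
Local Notation K := ((32 * pi ^+ 2)^-1 : R).

(* The pullback along the chart is returned as an abstract function F: rewriting
   with terms in [lmc (chart _ _) (tmap _ _ _)] makes unification unfold them and
   diverge. *)
Lemma lmc_chart_path p (g C E : tupR p) j : NG g -> skews C ->
  exists F : R -> 'M[R]_4,
    [/\ forall t, lmc (chart g (0 + t *: C)) (tmap (chart g) (0 + t *: C) E) j = F t,
        F 0 = E j & is_derive (0 : R) 1 F (- 2^-1 *: lie (C j) (E j))].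
Proof.
move=> gS Cs; exists (fun t =>
  lmc (chart g (0 + t *: C)) (tmap (chart g) (0 + t *: C) E) j).
split=> //; last exact: is_derive_lmc_chart.
rewrite lmc_chart //; last exact/skews_line/Cs/skews0.
by rewrite tupD0 [(0 : tupR p) j]/(0 : 'M[R]_4) cay0 trmx1 mul1mx mulmx1.
Qed.

Lemma rmc_chart_path p (g C E : tupR p) j : NG g -> skews C ->
  exists F : R -> 'M[R]_4,
    [/\ forall t, rmc (chart g (0 + t *: C)) (tmap (chart g) (0 + t *: C) E) j = F t,
        F 0 = g j *m E j *m (g j)^T &
        is_derive (0 : R) 1 F (2^-1 *: (g j *m lie (C j) (E j) *m (g j)^T))].
Proof.
move=> gS Cs; exists (fun t =>
  rmc (chart g (0 + t *: C)) (tmap (chart g) (0 + t *: C) E) j).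
split=> //; last exact: is_derive_rmc_chart.
rewrite rmc_chart //; last exact/skews_line/Cs/skews0.
by rewrite tupD0 [(0 : tupR p) j]/(0 : 'M[R]_4) cay0 trmx1 !mulmx1.
Qed.

Lemma rmc_lmc p (g v : tupR p) j : NG g -> rmc g v j = g j *m lmc g v j *m (g j)^T.
Proof.
move=> gS; rewrite -(SO4_inv (gS j)) /lmc mulmxA mulmxV ?SO4_unit //.
by rewrite mul1mx.
Qed.

(** Reduces an exterior derivative to one derivative per argument, along a line in the chart on
    which the other coordinate vectors stay constant. *)
Lemma dextE p k (w : dform p k) (g : tupR p) (v : 'I_k.+1 -> tupR p) (D : 'I_k.+1 -> R) :
  (forall i, is_derive (0 : R) 1
    (fun t => w (chart g (0 + t *: lmc g (v i)))
      (fun j => tmap (chart g) (0 + t *: lmc g (v i)) (lmc g (v (lift i j))))) (D i)) ->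
  dext w g v = \sum_(i < k.+1) (-1) ^+ i * D i.
Proof.
by move=> wD; apply: eq_bigr => i _; rewrite derive1E; have [_ <-] := wD i.
Qed.

Lemma lie_SO4 (g A B : 'M[R]_4) : SO4 g ->
  lie (g *m A *m g^T) (g *m B *m g^T) = g *m lie A B *m g^T.
Proof.
by case=> gg _; rewrite /lie !mulmxA -!(mulmxA _ g^T g) gg !mulmx1 mulmxBr mulmxBl !mulmxA.
Qed.

Lemma is_derive_lie (F G : R -> 'M[R]_4) dF dG (t : R) :
  is_derive t 1 F dF -> is_derive t 1 G dG ->
  is_derive t 1 (fun x => lie (F x) (G x)) (lie dF (G t) + lie (F t) dG).
Proof.
move=> Fd Gd; have := is_deriveB (is_derive_mulmx Fd Gd) (is_derive_mulmx Gd Fd).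
by move/is_derive_eq; apply; rewrite /lie [in RHS]addrACA opprD [- _ - _]addrC.
Qed.

(** X is constant, so only d theta = - theta^2 and d rho = rho^2 enter. *)
Lemma dext_mu X (g : tupR 1) (v : 'I_2 -> tupR 1) : NG g -> (forall i, tangent g (v i)) ->
  dext (mu X) g v = - K *
    (pf X (lie (rmc g (v ord0) ord0) (rmc g (v o1) ord0)) -
     pf X (lie (lmc g (v ord0) ord0) (lmc g (v o1) ord0))).
Proof.
move=> gS vg; pose c i : tupR 1 := lmc g (v i).
have cs i : skews (c i) by exact: vg.
pose D (C E : tupR 1) := - K * (pf X (- 2^-1 *: lie (C ord0) (E ord0)) +
  pf X (2^-1 *: (g ord0 *m lie (C ord0) (E ord0) *m (g ord0)^T))).
apply: (etrans (@dextE 1 1 (mu X) g v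
  (fun i => D (c i) (c (lift i ord0))) _)) => [i|]; last first.
  rewrite !big_ord_recl big_ord0 /= expr0 expr1 mul1r mulN1r addr0.
  have -> : lift o1 ord0 = ord0 :> 'I_2 by exact: val_inj.
  (* The two directions contribute equally by antisymmetry of the bracket, which absorbs the factors
     1/2. *)
  rewrite /D (lieC (c o1 _)) !rmc_lmc // -/(c _) !pfZr.
  rewrite mulmxN mulNmx !pfNr lie_SO4 // -!/(c _).
  by move: (pf _ _) (pf _ _) (_^-1) => x y k; field.
under eq_fun do rewrite muE.
have X0 := is_derive_cst X (0 : R) 1.
have H := is_derive_mul (is_derive_cst (- K) (0 : R) 1)
  (is_deriveD (is_derive_pf X0 (is_derive_lmc_chart (c (lift i ord0)) ord0 gS (cs i)))
              (is_derive_pf X0 (is_derive_rmc_chart (c (lift i ord0)) ord0 gS (cs i)))).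
by apply: (is_derive_eq H); rewrite /cst !pf0l mul0r !add0r.
Qed.

(** Leibniz rule: H E F is the derivative along C of P(theta_1 E, rho_2 F) at the centre of the
    chart. *)
Lemma is_derive_E22_chart (g C : tupR 2) (u : 'I_2 -> tupR 2) : NG g -> skews C ->
  let g1 := g ord_max in
  let H (E F : tupR 2) :=
    pf (- 2^-1 *: lie (C ord0) (E ord0)) (g1 *m F ord_max *m g1^T) +
    pf (E ord0) (2^-1 *: (g1 *m lie (C ord_max) (F ord_max) *m g1^T)) in
  is_derive (0 : R) 1 (fun t => @E22 R (chart g (0 + t *: C))
      (fun j => tmap (chart g) (0 + t *: C) (u j)))
    (- K * (H (u ord0) (u o1) - H (u o1) (u ord0))).
Proof.
move=> gS Cs /=.
have [L0 [L0E L00 dL0]] := lmc_chart_path (u ord0) ord0 gS Cs.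
have [L1 [L1E L10 dL1]] := lmc_chart_path (u o1) ord0 gS Cs.
have [R0 [R0E R00 dR0]] := rmc_chart_path (u ord0) ord_max gS Cs.
have [R1 [R1E R10 dR1]] := rmc_chart_path (u o1) ord_max gS Cs.
have -> : (fun t => @E22 R (chart g (0 + t *: C))
      (fun j => tmap (chart g) (0 + t *: C) (u j))) =
    (fun t => - K * (pf (L0 t) (R1 t) - pf (L1 t) (R0 t))).
  by apply/funext => t; rewrite -L0E -L1E -R0E -R1E; exact: E22E.
have T := is_derive_mul (is_derive_cst (- K) (0 : R) 1)
  (is_deriveB (is_derive_pf dL0 dR1) (is_derive_pf dL1 dR0)).
by apply: (is_derive_eq T); rewrite /cst mul0r add0r L00 L10 R00 R10.
Qed.

(** Each theta moves by - (ad C)/2 to first order. As ad C is a derivation of the bracket and skew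
    for [pf], the trilinear form P(A, [B, D]) is stationary. *)
Lemma is_derive_E13_chart (g C : tupR 1) (u : 'I_3 -> tupR 1) :
  NG g -> skews C -> (forall j, skews (u j)) ->
  is_derive (0 : R) 1 (fun t => @E13 R (chart g (0 + t *: C))
      (fun j => tmap (chart g) (0 + t *: C) (u j))) 0.
Proof.
move=> gS Cs us.
have tv t j : tangent (chart g (0 + t *: C)) (tmap (chart g) (0 + t *: C) (u j)).
  by apply: tangent_chart => //; exact: (skews_line _ (@skews0 R 1)).
have [L0 [L0E L00 dL0]] := lmc_chart_path (u ord0) ord0 gS Cs.
have [L1 [L1E L10 dL1]] := lmc_chart_path (u o1) ord0 gS Cs.
have [L2 [L2E L20 dL2]] := lmc_chart_path (u o2) ord0 gS Cs.
have -> : (fun t => @E13 R (chart g (0 + t *: C))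
      (fun j => tmap (chart g) (0 + t *: C) (u j))) =
    (fun t => K * pf (L0 t) (lie (L1 t) (L2 t))).
  by apply/funext => t; rewrite -L0E -L1E -L2E; exact: (E13E (tv t)).
have T := is_derive_mul (is_derive_cst K (0 : R) 1)
  (is_derive_pf dL0 (is_derive_lie dL1 dL2)).
apply: (is_derive_eq T); rewrite /cst mul0r add0r L00 L10 L20 pfZl pf_lie; last exact: Cs.
move: (C ord0) (u ord0 ord0) (u o1 ord0) (u o2 ord0) => Z A B D.
have -> : lie (- 2^-1 *: lie Z B) D + lie B (- 2^-1 *: lie Z D) = - 2^-1 *: lie Z (lie B D).
  by rewrite lieZl lieZr -scalerDr lie_jacobi.
by rewrite pfZr mulrN addNr mulr0.
Qed.

(** This is d(theta_1 /\ rho_2) = - theta_1^2 /\ rho_2 - theta_1 /\ rho_2^2, paired by P, multiplied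
    by - K and evaluated on three vectors. *)
Lemma dext_E22 (g : tupR 2) (v : 'I_3 -> tupR 2) : NG g -> (forall i, tangent g (v i)) ->
  let A i := lmc g (v i) ord0 in let B i := rmc g (v i) ord_max in
  dext (@E22 R) g v = K *
    (pf (lie (A ord0) (A o1)) (B o2) - pf (lie (A ord0) (A o2)) (B o1)
     + pf (lie (A o1) (A o2)) (B ord0) + pf (A ord0) (lie (B o1) (B o2))
     - pf (A o1) (lie (B ord0) (B o2)) + pf (A o2) (lie (B ord0) (B o1))).
Proof.
move=> gS vg A B; pose c i : tupR 2 := lmc g (v i).
have cs i : skews (c i) by exact: vg.
pose g1 := g ord_max.
pose H (C E F : tupR 2) :=
  pf (- 2^-1 *: lie (C ord0) (E ord0)) (g1 *m F ord_max *m g1^T) +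
  pf (E ord0) (2^-1 *: (g1 *m lie (C ord_max) (F ord_max) *m g1^T)).
have HE C E F : H C E F = 2^-1 *
    (pf (E ord0) (g1 *m lie (C ord_max) (F ord_max) *m g1^T) -
     pf (lie (C ord0) (E ord0)) (g1 *m F ord_max *m g1^T)).
  by rewrite /H pfZl pfZr mulNr addrC -mulrBr.
pose D (C E F : tupR 2) := - K * (H C E F - H C F E).
apply: (etrans (@dextE 2 2 (@E22 R) g v
  (fun i => D (c i) (c (lift i ord0)) (c (lift i o1))) _)) => [i|]; last first.
  have E1 : (lift o1 ord0 = ord0 :> 'I_3) * (lift o1 o1 = o2 :> 'I_3) *
      (lift o2 ord0 = ord0 :> 'I_3) * (lift o2 o1 = o1 :> 'I_3).
    by do !split; exact: val_inj.
  rewrite sum_sign3 !E1.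
  rewrite /B !rmc_lmc // -/g1 -!/(c _) /A -!/(c _) /D !HE.
  rewrite !lie_SO4 //; try exact: gS.
  (* Orienting all brackets by increasing argument index makes equal values of [pf] identical
     atoms. *)
  rewrite (lieC (c o1 ord0) (c ord0 _)) (lieC (c o2 ord0) (c ord0 _)).
  rewrite (lieC (c o2 ord0) (c o1 _)) (lieC (c o1 ord_max) (c ord0 _)).
  rewrite (lieC (c o2 ord_max) (c ord0 _)) (lieC (c o2 ord_max) (c o1 _)).
  rewrite !(mulmxN, mulNmx) !(pfNl, pfNr).
  move: (pf _ _) (pf _ _) (pf _ _) (pf _ _) (pf _ _) (pf _ _) (_^-1) => *.
  by field.
exact: (is_derive_E22_chart (fun j => c (lift i j)) gS (cs i)).
Qed.

Lemma dext_E13 (g : tupR 1) (v : 'I_4 -> tupR 1) : NG g -> (forall i, tangent g (v i)) ->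
  dext (@E13 R) g v = 0.
Proof.
move=> gS vg; pose c i : tupR 1 := lmc g (v i).
have cs i : skews (c i) by exact: vg.
apply: (etrans (@dextE 1 3 (@E13 R) g v (fun=> 0) _)) => [i|]; last first.
  by rewrite big1 // => i _; rewrite mulr0.
exact: (@is_derive_E13_chart g (c i) (fun j => c (lift i j)) gS (cs i) (fun=> cs _)).
Qed.

End ExteriorDerivatives.

(** * Face maps, conjugation and fundamental vector fields *)

Section FaceMaps.
Variable R : realType.
Local Notation tupR := (@tup R).

Lemma invmxM (A B : 'M[R]_4) : A \in unitmx -> B \in unitmx ->
  invmx (A *m B) = invmx B *m invmx A.
Proof.
move=> Au Bu; have ABu : A *m B \in unitmx by rewrite unitmx_mul Au.
apply: (can_inj (mulKmx ABu)); rewrite mulmxV // mulmxA mulmxK //.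
by rewrite mulmxV.
Qed.

Lemma pf_SO4_adj (g A B : 'M[R]_4) : SO4 g -> pf A (g^T *m B *m g) = pf (g *m A *m g^T) B.
Proof.
move=> gS; rewrite -(pf_SO4 A _ gS) -(SO4_inv gS) !mulmxA mulmxV ?SO4_unit //.
by rewrite mul1mx mulmxK // SO4_unit.
Qed.

Lemma tmap_face p (i : 'I_p.+2) (g v : tupR p.+1) j :
  tmap (face i) g v j =
  if (j.+1 < i)%N then v (widen_ord (leqnSn p) j)
  else if j.+1 == i then
    v (widen_ord (leqnSn p) j) *m g (lift ord0 j) +
    g (widen_ord (leqnSn p) j) *m v (lift ord0 j)
  else v (lift ord0 j).
Proof.
apply: tmapE; rewrite /face; case: ifP => _; first exact: is_derive_tup.
case: ifP => _; last exact: is_derive_tup.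
have := is_derive_mulmx (is_derive_tup g v (widen_ord (leqnSn p) j))
  (is_derive_tup g v (lift ord0 j)).
by rewrite !tupD0.
Qed.

Lemma lmc_face_lt p (i : 'I_p.+2) (g v : tupR p.+1) (j : 'I_p) : (j.+1 < i)%N ->
  lmc (face i g) (tmap (face i) g v) j = lmc g v (widen_ord (leqnSn p) j).
Proof. by move=> ji; rewrite /lmc tmap_face /face ji. Qed.

Lemma rmc_face_lt p (i : 'I_p.+2) (g v : tupR p.+1) (j : 'I_p) : (j.+1 < i)%N ->
  rmc (face i g) (tmap (face i) g v) j = rmc g v (widen_ord (leqnSn p) j).
Proof. by move=> ji; rewrite /rmc tmap_face /face ji. Qed.

Lemma lmc_face_gt p (i : 'I_p.+2) (g v : tupR p.+1) (j : 'I_p) : (i < j.+1)%N ->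
  lmc (face i g) (tmap (face i) g v) j = lmc g v (lift ord0 j).
Proof. by move=> ij; rewrite /lmc tmap_face /face ltnNge ltnW //= gtn_eqF. Qed.

Lemma rmc_face_gt p (i : 'I_p.+2) (g v : tupR p.+1) (j : 'I_p) : (i < j.+1)%N ->
  rmc (face i g) (tmap (face i) g v) j = rmc g v (lift ord0 j).
Proof. by move=> ij; rewrite /rmc tmap_face /face ltnNge ltnW //= gtn_eqF. Qed.

(** Multiplication pulls theta back to Ad(h_2^-1) theta_1 + theta_2. *)
Lemma lmc_face_eq p (i : 'I_p.+2) (g v : tupR p.+1) (j : 'I_p) : NG g -> j.+1 = i ->
  lmc (face i g) (tmap (face i) g v) j =
  (g (lift ord0 j))^T *m lmc g v (widen_ord (leqnSn p) j) *m g (lift ord0 j) +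
  lmc g v (lift ord0 j).
Proof.
move=> gS ji; rewrite /lmc tmap_face /face ji ltnn eqxx invmxM ?SO4_unit //.
rewrite -(SO4_inv (gS _)) mulmxDr !mulmxA; congr (_ + _).
by rewrite mulmxKV // SO4_unit.
Qed.

(** Multiplication pulls rho back to rho_1 + Ad(h_1) rho_2. *)
Lemma rmc_face_eq p (i : 'I_p.+2) (g v : tupR p.+1) (j : 'I_p) : NG g -> j.+1 = i ->
  rmc (face i g) (tmap (face i) g v) j =
  rmc g v (widen_ord (leqnSn p) j) +
  g (widen_ord (leqnSn p) j) *m rmc g v (lift ord0 j) *m (g (widen_ord (leqnSn p) j))^T.
Proof.
move=> gS ji; rewrite /rmc tmap_face /face ji ltnn eqxx invmxM ?SO4_unit //.
rewrite -(SO4_inv (gS _)) mulmxDl !mulmxA; congr (_ + _).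
by rewrite mulmxK // SO4_unit.
Qed.

Lemma tangent_face p (i : 'I_p.+2) (g v : tupR p.+1) : NG g -> tangent g v ->
  tangent (face i g) (tmap (face i) g v).
Proof.
move=> gS gv j; rewrite -/(lmc _ _ j); have [ji|ij|ij] := ltngtP j.+1 i.
- by rewrite lmc_face_lt //; exact: gv.
- by rewrite lmc_face_gt //; exact: gv.
rewrite lmc_face_eq // -{2}[g _]trmxK /so4 linearD /= gv opprD; congr (_ + _).
exact/so4_conj/gv.
Qed.

Lemma tmap_conj p k (g v : tupR p) j : tmap (conj_act k) g v j = k *m v j *m invmx k.
Proof.
apply: tmapE.
have := is_derive_mulmx (is_derive_mulmx (is_derive_cst k (0 : R) 1) (is_derive_tup g v j))
  (is_derive_cst (invmx k) (0 : R) 1).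
by move/is_derive_eq; apply; rewrite /cst mulmx0 addr0 mul0mx add0r.
Qed.

Lemma lmc_conj p k (g v : tupR p) j : SO4 k -> NG g ->
  lmc (conj_act k g) (tmap (conj_act k) g v) j = k *m lmc g v j *m k^T.
Proof.
move=> kS gS; have ku := SO4_unit kS; have gu := SO4_unit (gS j).
rewrite /lmc tmap_conj /conj_act -(SO4_inv kS) !invmxM ?unitmx_mul ?unitmx_inv ?ku ?gu //.
by rewrite invmxK !mulmxA mulmxKV.
Qed.

Lemma rmc_conj p k (g v : tupR p) j : SO4 k -> NG g ->
  rmc (conj_act k g) (tmap (conj_act k) g v) j = k *m rmc g v j *m k^T.
Proof.
move=> kS gS; have ku := SO4_unit kS; have gu := SO4_unit (gS j).
rewrite /rmc tmap_conj /conj_act -(SO4_inv kS) !invmxM ?unitmx_mul ?unitmx_inv ?ku ?gu //.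
by rewrite invmxK !mulmxA mulmxKV.
Qed.

Lemma tangent_conj p k (g v : tupR p) : SO4 k -> NG g -> tangent g v ->
  tangent (conj_act k g) (tmap (conj_act k) g v).
Proof.
by move=> kS gS gv j; rewrite -/(lmc _ _ j) lmc_conj //; apply/so4_conj/gv.
Qed.

Lemma lmc_fundvf p X (g : tupR p) j : NG g ->
  lmc g (fundvf X g) j = X - (g j)^T *m X *m g j.
Proof.
by move=> gS; rewrite /lmc /fundvf -(SO4_inv (gS j)) mulmxBr mulKmx ?SO4_unit // !mulmxA.
Qed.

Lemma rmc_fundvf p X (g : tupR p) j : NG g ->
  rmc g (fundvf X g) j = g j *m X *m (g j)^T - X.
Proof.
by move=> gS; rewrite /rmc /fundvf -(SO4_inv (gS j)) mulmxBl mulmxK ?SO4_unit.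
Qed.

Lemma tangent_fundvf p X (g : tupR p) : NG g -> so4 X -> tangent g (fundvf X g).
Proof.
move=> gS Xsk j; rewrite -/(lmc _ _ j) lmc_fundvf // -{2}[g j]trmxK /so4 linearB /=.
by rewrite so4_conj // Xsk opprB addrC opprK.
Qed.

End FaceMaps.

(** * The cocycle identities *)

Section CocycleIdentities.
Variable R : realType.
Local Notation tupR := (@tup R).
Local Notation K := ((32 * pi ^+ 2)^-1 : R).

(** The terms P(X, X) cancel, and so do P(X, h^-1 X h) and P(X, h X h^-1), equal by invariance and
    symmetry. *)
Lemma contract_mu X (g : tupR 1) v : NG g -> contractf (fundvf X) (mu X) g v = 0.
Proof.
move=> gS; rewrite /contractf muE unlift_none lmc_fundvf // rmc_fundvf //.
rewrite pfDr pfDr !pfNr pf_SO4_adj // (pfC _ X).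
by rewrite addrC addrA subrK subrr mulr0.
Qed.

(** The contraction is K P(X - h^-1 X h, [theta, theta]); moving the conjugation across P turns the
    second bracket into [rho, rho]. *)
Lemma dG_mu_E13 X (g : tupR 1) (v : 'I_2 -> tupR 1) : so4 X -> NG g ->
  (forall i, tangent g (v i)) ->
  dext (mu X) g v = contractf (fundvf X) (@E13 R) g v.
Proof.
move=> Xsk gS gv; rewrite dext_mu // /contractf.
set u := fun i : 'I_3 => _.
have u0 : u ord0 = fundvf X g by rewrite /u unlift_none.
have uS j : u (lift ord0 j) = v j by rewrite /u liftK.
have gu i : tangent g (u i).
  by case: (unliftP ord0 i) => [j|] ->; rewrite ?u0 ?uS //; exact: tangent_fundvf.
rewrite (E13E gu) u0 !uS lmc_fundvf // pfDl pfNl !rmc_lmc // lie_SO4 //.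
rewrite [in RHS](pfC (_ *m X *m _)) pf_SO4_adj // (pfC _ X).
by rewrite mulNr -mulrN opprB.
Qed.

Lemma widen_ord0 n : widen_ord (leqnSn n.+1) ord0 = ord0.
Proof. exact: val_inj. Qed.

(** The alternating sum of the theta and rho terms is theta_1 + rho_2 - Ad(h_2^-1) theta_1 - Ad(h_1)
    rho_2. The contraction of [E22] yields the same after the conjugations of X are moved across
    P. *)
Lemma dsimp_mu X (g : tupR 2) (v : 'I_1 -> tupR 2) : NG g ->
  \sum_(i < 3) (-1) ^+ i * pullback (face i) (mu X) g v =
  contractf (fundvf X) (@E22 R) g v.
Proof.
move=> gS; rewrite sum_sign3 /pullback /contractf.
set u := fun i : 'I_2 => _.
have u0 : u ord0 = fundvf X g by rewrite /u unlift_none.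
have uS j : u (lift ord0 j) = v j by rewrite /u liftK.
rewrite E22E u0 !uS lmc_fundvf // rmc_fundvf //.
have om : lift ord0 ord0 = ord_max :> 'I_2 by exact: val_inj.
rewrite !muE (lmc_face_gt (i := ord0)) // (rmc_face_gt (i := ord0)) //.
rewrite (lmc_face_eq (i := o1)) // (rmc_face_eq (i := o1)) //.
rewrite (lmc_face_lt (i := o2)) // (rmc_face_lt (i := o2)) //.
rewrite !widen_ord0 om.
move: (lmc g (v ord0) ord0) (lmc g (v ord0) ord_max) => a b.
move: (rmc g (v ord0) ord0) (rmc g (v ord0) ord_max) => c d.
rewrite !(pfDl, pfDr, pfNl, pfNr) (pf_SO4_adj X a) // (pfC a (_ *m _)) (pfC a X).
rewrite (pfC (_ *m X *m _) d) pf_SO4_adj // (pfC (_ *m d *m _) X).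
move: (pf _ _) (pf _ _) (pf _ _) (pf _ _) (pf _ _) (pf _ _) (_^-1) => *.
by ring.
Qed.

(** All terms cancel in pairs; the mixed pair is P(Ad(h_2^-1) theta_1, rho_3) = P(theta_1, Ad(h_2)
    rho_3). *)
Lemma dsimp_E22 (g : tupR 3) (v : 'I_2 -> tupR 3) : NG g ->
  \sum_(i < 4) (-1) ^+ i * pullback (face i) (@E22 R) g v = 0.
Proof.
move=> gS.
have w1 : widen_ord (leqnSn 2) ord_max = o1 by exact: val_inj.
have l2 : lift ord0 (@ord_max 1) = o2 by exact: val_inj.
have [L LE] : exists L, forall i j, L i j = lmc (face i g) (tmap (face i) g (v j)) ord0.
  by eexists => i j.
have [M ME] : exists M, forall i j, M i j = rmc (face i g) (tmap (face i) g (v j)) ord_max.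
  by eexists => i j.
have E i : pullback (face i) (@E22 R) g v =
    - K * (pf (L i ord0) (M i o1) - pf (L i o1) (M i ord0)).
  by rewrite !LE !ME; exact: E22E.
rewrite sum_sign4 !E.
have L0 j : L ord0 j = lmc g (v j) o1 by rewrite LE lmc_face_gt.
have M0 j : M ord0 j = rmc g (v j) o2 by rewrite ME rmc_face_gt // l2.
have L1 j : L o1 j = (g o1)^T *m lmc g (v j) ord0 *m g o1 + lmc g (v j) o1.
  by rewrite LE lmc_face_eq // widen_ord0.
have M1 j : M o1 j = rmc g (v j) o2 by rewrite ME rmc_face_gt // l2.
have L2 j : L o2 j = lmc g (v j) ord0 by rewrite LE lmc_face_lt // widen_ord0.
have M2 j : M o2 j = rmc g (v j) o1 + g o1 *m rmc g (v j) o2 *m (g o1)^T.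
  by rewrite ME rmc_face_eq // w1 l2.
have L3 j : L (lift ord0 o2) j = lmc g (v j) ord0 by rewrite LE lmc_face_lt // widen_ord0.
have M3 j : M (lift ord0 o2) j = rmc g (v j) o1 by rewrite ME rmc_face_lt // w1.
rewrite !L0 !M0 !L1 !M1 !L2 !M2 !L3 !M3.
move: (lmc g (v ord0) ord0) (lmc g (v ord0) o1) => a b.
move: (rmc g (v ord0) o1) (rmc g (v ord0) o2) => c d.
move: (lmc g (v o1) ord0) (lmc g (v o1) o1) => a' b'.
move: (rmc g (v o1) o1) (rmc g (v o1) o2) => c' d'.
rewrite !(pfDl, pfDr) !(pfC (_ *m _ *m g o1)) !pf_SO4_adj // !(pfC (_ *m _ *m _^T)).
move: (pf _ _) (pf _ _) (pf _ _) (pf _ _) (pf _ _) (pf _ _) (_^-1) => *.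
by ring.
Qed.

(** With a = theta_1 and b = rho_2, invariance turns the three pullbacks into the trilinear form at
    b, at a + b and at a. What remains of the alternating sum are the mixed terms, which d E_(2,2)
    cancels. *)
Lemma dsimp_E13 (g : tupR 2) (v : 'I_3 -> tupR 2) : NG g -> (forall i, tangent g (v i)) ->
  \sum_(i < 3) (-1) ^+ i * pullback (face i) (@E13 R) g v + dext (@E22 R) g v = 0.
Proof.
move=> gS gv; have [L LE] : exists L, forall i j,
    L i j = lmc (face i g) (tmap (face i) g (v j)) ord0 by eexists => i j.
have E i : pullback (face i) (@E13 R) g v =
    K * pf (L i ord0) (lie (L i o1) (L i o2)).
  by rewrite !LE; apply: E13E => j; exact: tangent_face.
have := dext_E22 gS gv; cbv zeta => ->; rewrite sum_sign3 !E.
have om : lift ord0 ord0 = ord_max :> 'I_2 by exact: val_inj.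
have F0 i : L ord0 i = lmc g (v i) ord_max by rewrite LE lmc_face_gt // om.
have F1 i : L o1 i = (g ord_max)^T *m lmc g (v i) ord0 *m g ord_max + lmc g (v i) ord_max.
  by rewrite LE lmc_face_eq // widen_ord0 om.
have F2 i : L o2 i = lmc g (v i) ord0 by rewrite LE lmc_face_lt // widen_ord0.
rewrite !F0 !F1 !F2.
have Ask i : so4 (lmc g (v i) ord0) by exact: gv.
have Bsk i : so4 (rmc g (v i) ord_max) by rewrite rmc_lmc //; exact/so4_conj/gv.
(* Since theta_2 = Ad(h_2^-1) rho_2, the pullback of theta under multiplication is Ad(h_2^-1)
   (theta_1 + rho_2). *)
have FB i : (g ord_max)^T *m lmc g (v i) ord0 *m g ord_max + lmc g (v i) ord_max =
    (g ord_max)^T *m (lmc g (v i) ord0 + rmc g (v i) ord_max) *m (g ord_max)^T^T.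
  rewrite rmc_lmc // trmxK mulmxDr mulmxDl -(SO4_inv (gS _)); congr (_ + _).
  by rewrite !mulmxA mulVmx ?SO4_unit // mul1mx mulmxKV // SO4_unit.
have FD : pf (lmc g (v ord0) ord_max) (lie (lmc g (v o1) ord_max) (lmc g (v o2) ord_max)) =
    pf (rmc g (v ord0) ord_max) (lie (rmc g (v o1) ord_max) (rmc g (v o2) ord_max)).
  by rewrite !rmc_lmc // lie_SO4 // pf_SO4.
rewrite FD !FB; have gT := SO4_trmx (gS ord_max); rewrite lie_SO4 // pf_SO4 //.
move: (Ask ord0) (Ask o1) (Ask o2) (Bsk ord0) (Bsk o1) (Bsk o2).
move: (lmc g (v ord0) ord0) (lmc g (v o1) ord0) (lmc g (v o2) ord0) => a0 a1 a2.
move: (rmc g (v ord0) ord_max) (rmc g (v o1) ord_max) (rmc g (v o2) ord_max) => b0 b1 b2.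
move=> a0s a1s a2s b0s b1s b2s {FD FB F0 F1 F2 Ask Bsk}.
(* Trilinear expansion, with the mixed terms rotated into the order in which [dext_E22] lists
   them. *)
have -> : pf (a0 + b0) (lie (a1 + b1) (a2 + b2)) =
    pf a0 (lie a1 a2) + pf b2 (lie a0 a1) - pf b1 (lie a0 a2) + pf a0 (lie b1 b2)
    + pf b0 (lie a1 a2) - pf a1 (lie b0 b2) + pf a2 (lie b0 b1) + pf b0 (lie b1 b2).
  rewrite -(pf_lie_rot a0 b2 a1s) -(pf_lie_rot b0 a2 b1s) -(pf_lie_rot a0 b1 a2s).
  rewrite -(pf_lie_rot b0 a1 b2s) (lieC a2 b1) (lieC b2 a1) !pfNr lieDl !lieDr.
  by move: (lie _ _) (lie _ _) (lie _ _) (lie _ _) => *; rewrite !(pfDl, pfDr); ring.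
rewrite !(pfC (lie _ _)).
move: (pf _ _) (pf _ _) (pf _ _) (pf _ _) (pf _ _) (pf _ _) (pf _ _) (pf _ _) (_^-1) => *.
by ring.
Qed.

End CocycleIdentities.

(** * Bidegrees of the total cochain and assembly of the cocycle *)

Section Assembly.
Variable R : realType.
Local Notation tupR := (@tup R).
Local Notation K := ((32 * pi ^+ 2)^-1 : R).

Definition zero_eqform p : eqform p := fun _ k => @zerof R p k.

(** The part on NG(1), of total degree 3: form degree 1 with polynomial degree 1, and form degree 3
    with polynomial degree 0. *)
Definition total1 : eqform 1 := fun X k =>
  match k return dform 1 k with 1 => @mu R X | 3 => @E13 R | _ => @zerof R 1 _ end.

Definition total2 : eqform 2 := fun _ k =>
  match k return dform 2 k with 2 => @E22 R | _ => @zerof R 2 _ end.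

Definition total : @cochain R := addc (addc (@E13c R) (@E22c R)) (@muc R).
#[local] Arguments total p _ k _ _ : clear implicits.

Lemma totalE (p : nat) : total p = match p return eqform p with
  1 => total1 | 2 => total2 | _ => @zero_eqform _ end.
Proof.
apply/funext => X; apply: functional_extensionality_dep => k.
apply/funext => g; apply/funext => v.
case: p g v => [|[|[|p]]] g v; rewrite /total /addc /= /zero_eqform /zerof ?addr0 //.
  by case: k v => [|[|[|[|k]]]] v; rewrite /zerof ?addr0 ?add0r.
by case: k v => [|[|[|k]]] v; rewrite /zerof ?addr0 ?add0r.
Qed.

Lemma dext_zero p k (g : tupR p) v : dext (@zerof R p k) g v = 0.
Proof.
rewrite /dext /dflat big1 // => i _; rewrite /pullback /zerof.
by rewrite derive1_cst mulr0.
Qed.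

Lemma dG_zero p X k (g : tupR p) v : dG (@zero_eqform p) X k g v = 0.
Proof.
rewrite /dG /contractf /zero_eqform /zerof subr0; case: k v => // k v.
exact: dext_zero.
Qed.

Lemma dsimp_zero p (a : eqform p) X k (g : tupR p.+1) v :
  a X k = @zerof R p k -> dsimp a X k g v = 0.
Proof. by move=> aX; rewrite /dsimp big1 // => i _; rewrite aX /pullback /zerof mulr0. Qed.

Lemma homog_zero p k m : homog m (fun X => @zerof R p k).
Proof.
exists (fun=> @zerof R p k); split=> [s|X _ g v _ _]; first exact: is_form_zero.
by rewrite big1 // => s _; rewrite /zerof mulr0.
Qed.

Lemma is_eqform_zero p q : is_eqform q (@zero_eqform p).
Proof. by split=> // k m _; exact: homog_zero. Qed.

Lemma homog0 p k (w : dform p k) : is_form w -> homog 0 (fun _ : 'M[R]_4 => w).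
Proof.
move=> wF; exists (fun=> w); split=> // X _ g v _ _.
rewrite (big_pred1 [tuple]) => [|s]; last by rewrite [s]tuple0 /= eqxx.
by rewrite big_ord0 mul1r.
Qed.

Lemma mu_sum I (r : seq I) (P : pred I) (F : I -> 'M[R]_4) g v :
  mu (\sum_(i <- r | P i) F i) g v = \sum_(i <- r | P i) mu (F i) g v.
Proof.
elim/big_rec2: _ => [|i y z _ <-]; rewrite !muE; first by rewrite !pf0l addr0 mulr0.
by rewrite !pfDl; ring.
Qed.

(** [mu] is linear on all matrices, so X is expanded in matrix units; the coefficient forms are the
    values of [mu] at these, although they lie outside so(4). *)
Lemma homog_mu : homog 1 (@mu R).
Proof.
exists (fun s => mu (delta_mx (tnth s ord0).1 (tnth s ord0).2)); split=> [s|X _ g v _ _].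
  exact: is_form_mu.
rewrite {1}(matrix_sum_delta X) mu_sum.
under eq_bigr do rewrite mu_sum.
rewrite pair_big /= (reindex (fun s : 1.-tuple _ => tnth s ord0)) /=; last first.
  exists (fun x => [tuple x]) => [s _|x _]; last by [].
  by apply: eq_from_tnth => i; rewrite !ord1.
by apply: eq_bigr => s _; rewrite big_ord1 !muE !pfZl; ring.
Qed.

Lemma conj_mx_SO4 (k : 'M[R]_4) X : SO4 k -> k *m X *m invmx k = k *m X *m k^T.
Proof. by move=> kS; rewrite SO4_inv. Qed.

Lemma is_eqform_total1 : is_eqform 3 total1.
Proof.
split.
(* The ring addition on [nat] is first read as [addn]. Then k + 2m = 3 leaves m = 0, k = 3 for [E13]
   and m = 1, k = 1 for [mu]. *)
- move=> k m; rewrite -[(k + m.*2)%R]/(k + m.*2)%N.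
  case: m => [|[|m]]; rewrite ?doubleS ?double0 ?addn0.
  + by move=> ->; exact/homog0/is_form_E13.
  + by rewrite addn2 => -[->]; exact: homog_mu.
  by rewrite !addnS.
- case=> [|[|[|[|k]]]] //= km; first by case: (km 1%N).
  by case: (km 0%N).
move=> k X [|[|[|[|n]]]] kS Xsk g v gS gv //=; rewrite /pullback.
  rewrite !muE lmc_conj // rmc_conj // conj_mx_SO4 // !pf_SO4 //.
have [L LE] : exists L, forall i,
    L i = lmc (conj_act k g) (tmap (conj_act k) g (v i)) ord0 by eexists => i.
transitivity (K * pf (L ord0) (lie (L o1) (L o2))).
  by rewrite !LE; apply: E13E => i; exact: tangent_conj.
have LC i : L i = k *m lmc g (v i) ord0 *m k^T by rewrite LE lmc_conj.
by rewrite !LC lie_SO4 // pf_SO4 // E13E.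
Qed.

Lemma is_eqform_total2 : is_eqform 2 total2.
Proof.
split.
(* Here k + 2m = 2 leaves m = 0 with [E22], and m = 1, k = 0 with the zero form. *)
- move=> k m; rewrite -[(k + m.*2)%R]/(k + m.*2)%N.
  case: m => [|[|m]]; rewrite ?doubleS ?double0 ?addn0.
  + by move=> ->; exact/homog0/is_form_E22.
  + by rewrite addn2 => -[->]; exact: homog_zero.
  by rewrite !addnS.
- by case=> [|[|[|k]]] //= km; case: (km 0%N).
move=> k X [|[|[|n]]] kS Xsk g v gS gv //=; rewrite /pullback.
have [L LE] : exists L, forall i,
    L i = lmc (conj_act k g) (tmap (conj_act k) g (v i)) ord0 by eexists => i.
have [M ME] : exists M, forall i,
    M i = rmc (conj_act k g) (tmap (conj_act k) g (v i)) ord_max by eexists => i.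
transitivity (- K * (pf (L ord0) (M o1) - pf (L o1) (M ord0))).
  by rewrite !LE !ME; exact: E22E.
have LC i : L i = k *m lmc g (v i) ord0 *m k^T by rewrite LE lmc_conj.
have MC i : M i = k *m rmc g (v i) ord_max *m k^T by rewrite ME rmc_conj.
by rewrite !LC !MC !pf_SO4 // E22E.
Qed.

(** Case analysis on simplicial degree p and form degree k. The nontrivial identities sit at (p, k)
    = (1, 0), (1, 2), (1, 4), (2, 1), (2, 3) and (3, 2). *)
Lemma dtot_total X p k (g : tupR p) v : so4 X -> NG g -> (forall i, tangent g (v i)) ->
  dtot total p X k g v = 0.
Proof.
move=> Xsk gS gv; rewrite /dtot !totalE.
case: p g v gS gv => [|[|[|p]]] g v gS gv; rewrite ?totalE.
- by rewrite dG_zero mulr0 addr0.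
- rewrite dsimp_zero // add0r /dG.
  case: k v gv => [|[|[|[|[|k]]]]] v gv /=.
  + by rewrite contract_mu // subr0 mulr0.
  + by rewrite dext_zero /contractf /zerof subr0 mulr0.
  + by rewrite (dG_mu_E13 Xsk gS gv) subrr mulr0.
  + by rewrite dext_zero /contractf /zerof subr0 mulr0.
  + by rewrite (dext_E13 gS gv) /contractf /zerof subr0 mulr0.
  by rewrite dext_zero /contractf /zerof subr0 mulr0.
- rewrite expr2 mulrNN !mul1r /dG.
  case: k v gv => [|[|[|[|k]]]] v gv /=.
  + by rewrite dsimp_zero // /contractf /zerof subr0 addr0.
  + by rewrite dext_zero [dsimp _ _ _ _ _](dsimp_mu X v gS) add0r subrr.
  + by rewrite dsimp_zero // dext_zero /contractf /zerof subr0 addr0.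
  + by rewrite /contractf /zerof subr0; exact: (dsimp_E13 gS gv).
  by rewrite dsimp_zero // dext_zero /contractf /zerof subr0 addr0.
(* From p = 3 on the cochain itself vanishes, so only d' of the preceding component remains; it can
   be nonzero only for p = 3, coming from [E22]. *)
rewrite dG_zero mulr0 addr0; case: p g v gS gv => [|p] g v gS gv /=; last exact: dsimp_zero.
case: k v gv => [|[|[|k]]] v gv; try exact: dsimp_zero.
exact: (dsimp_E22 v gS).
Qed.

End Assembly.

Theorem theorem4p4 (R : realType) :
  is_cocycle 4 (addc (addc (@E13c R) (@E22c R)) (@muc R)).
Proof.
change (is_cocycle 4 (@total R)).
split=> [p|p X k Xsk g v gS gv]; last exact: (@dtot_total R X p k g v).
(* Only p = 1 and p = 2 carry nonzero components, of degrees 4 - 1 = 3 and 4 - 2 = 2. *)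
rewrite totalE; case: p => [|[|[|[|[|p]]]]] //=; try exact: is_eqform_zero.
  exact: is_eqform_total1.
exact: is_eqform_total2.
Qed.
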